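(* Let $m,n\ge 1$ and let $k_1,\dots,k_n$ and $l_1,\dots,l_m$ be non-negative integers. Let $\Delta=\Delta^{k_1,\ldots,k_n;l_1,\ldots,l_m}_{m,n}$ be the simplicial complex whose vertices are the cells of a chessboard with $n$ rows and $m$ columns, and whose simplices are the rook placements (sets of cells) having at most $k_i$ rooks in the $i$-th row for each $i\in[n]$ and at most $l_j$ rooks in the $j$-th column for each $j\in[m]$. If \[l_1+l_2+\cdots+l_m\ \ge\ k_1+k_2+\cdots+k_n+n-1,\] then $\Delta$ is $(k_1+k_2+\cdots+k_n-2)$-connected.
   Context: A topological space is $c$-connected if it is nonempty and its homotopy groups $\pi_t$ vanish for all $0\le t\le c$ (with the usual convention that every space is $(-2)$-connected and $(-1)$-connected means nonempty). *)

(* Defs.v *)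
From HB Require Import structures.
From mathcomp Require Import all_boot all_order all_algebra.
From mathcomp Require Import all_classical all_reals all_analysis.
Unset Printing Implicit Defensive.
Import Order.TTheory GRing.Theory Num.Theory.
Import numFieldNormedType.Exports.
Local Open Scope classical_set_scope.
Local Open Scope ring_scope.

Definition sphere (R : realType) (t : nat) : set 'rV[R]_t.+1 :=
  [set v | \sum_(i < t.+1) v ord0 i ^+ 2 = 1].

Definition sph_base (R : realType) (t : nat) : 'rV[R]_t.+1 :=
  \row_(i < t.+1) (if i == ord0 then 1 else 0).

Definition pi_trivial (R : realType) (T : topologicalType) (X : set T) (x0 : T)
    (t : nat) : Prop :=
  forall f : 'rV[R]_t.+1 -> T,
    {within sphere R t, continuous f} ->
    f @` sphere R t `<=` X ->
    f (sph_base R t) = x0 ->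
    exists H : 'rV[R]_t.+1 * R -> T,
      [/\ {within sphere R t `*` [set` `[(0:R), 1]], continuous H},
          H @` (sphere R t `*` [set` `[(0:R), 1]]) `<=` X,
          (forall v, sphere R t v -> H (v, 0) = f v /\ H (v, 1) = x0) &
          (forall s, [set` `[0, 1]] s -> H (sph_base R t, s) = x0)].

Definition c_connected (R : realType) (T : topologicalType) (c : int)
    (X : set T) : Prop :=
  ((-1 <= c)%R -> X !=set0) /\
  forall t : nat, (t%:Z <= c)%R -> forall x0, X x0 -> @pi_trivial R T X x0 t.

Definition rook_face (n m : nat) (k : 'I_n -> nat) (l : 'I_m -> nat)
    (A : {set 'I_n * 'I_m}) : bool :=
  [forall i, #|[set c in A | c.1 == i]| <= k i]%N &&
  [forall j, #|[set c in A | c.2 == j]| <= l j]%N.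

(* Geometric realization of a simplicial complex Delta on the vertex set
   'I_n * 'I_m, embedded in R^(n x m) (matrices) with vertex (i,j) the
   standard basis matrix: points with nonnegative barycentric coordinates
   summing to 1 whose support is a face of Delta. *)
Definition realization (R : realType) (n m : nat)
    (Delta : {set 'I_n * 'I_m} -> bool) : set 'M[R]_(n, m) :=
  [set x : 'M[R]_(n, m) | (forall i j, 0 <= x i j) /\
           \sum_(i < n) \sum_(j < m) x i j = 1 /\
           Delta (finset (fun c : 'I_n * 'I_m => x c.1 c.2 != 0))].

Arguments c_connected R {T} c X.

(* Main.v *)
(* Let K be the sum of the k_i.  Fix a cell v0 = (i0, j0) whose row and column
   have positive capacity, and build the complex from the star of v0, a cone, by
   attaching faces.  First attach the sets of k_(i0) cells of row i0 other than
   v0: they are pairwise incompatible, and the link of such a face T is the rook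
   complex without row i0 in which the capacity of the column of each cell of T
   and of column j0 has dropped by one.  Then attach the sets of l_(j0) cells of
   column j0 other than v0, whose links are rook complexes without column j0.
   The hypothesis on the capacities passes to the links, so by induction the
   link of an attached face T is (K - |T| - 2)-connected.  Attaching T glues a
   cone over (boundary of T) * (link of T), which is then (K - 3)-connected,
   and this preserves (K - 2)-connectedness.

   That a cone over a (c - 1)-connected L preserves c-connectedness is proved
   directly: a sphere of dimension at most c is cut into small cubes, the part
   mapped near the apex is replaced, cube by cube in order of dimension, by a map
   into L, and the old and new maps are joined by straight-line homotopies in
   the cone. *)
Require Import Defs.
From HB Require Import structures.
From mathcomp Require Import all_boot all_order all_algebra.
From mathcomp Require Import all_classical all_reals all_analysis.
From mathcomp Require Import zify ring lra.
Import Order.TTheory GRing.Theory Num.Theory.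
Import numFieldNormedType.Exports.
Local Open Scope classical_set_scope.
Local Open Scope ring_scope.
Set Implicit Arguments.
Unset Strict Implicit.

(** * Continuity and extension of maps from spheres *)

Lemma within_comp (T S U : topologicalType) (A : set T) (B : set S)
    (p : T -> S) (g : S -> U) :
  {within A, continuous p} -> (forall x, A x -> B (p x)) ->
  {within B, continuous g} -> {within A, continuous (fun x => g (p x))}.
Proof.
move=> /subspace_continuousP cp pAB /subspace_continuousP cg.
apply/subspace_continuousP => x Ax W /(cg _ (pAB _ Ax)) gW.
have := cp _ Ax _ gW; rewrite /nbhs /= /within /=.
by apply: filterS => y + Ay => /(_ Ay) /(_ (pAB _ Ay)).
Qed.

Lemma within_eq (T U : topologicalType) (A : set T) (f g : T -> U) :
  (forall x, A x -> g x = f x) ->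
  {within A, continuous f} -> {within A, continuous g}.
Proof.
by move=> fg; apply: subspace_eq_continuous => x; rewrite inE => /fg.
Qed.

Lemma within_glue (T U : topologicalType) (A B : set T) (f g h : T -> U) :
  closed A -> closed B ->
  {within A, continuous f} -> {within B, continuous g} ->
  (forall x, A x -> h x = f x) -> (forall x, B x -> h x = g x) ->
  {within A `|` B, continuous h}.
Proof.
move=> cA cB cf cg hf hg; apply: withinU_continuous => //.
- exact: within_eq cf.
- exact: within_eq cg.
Qed.

Lemma within_mx (R : realType) (T : topologicalType) (n m : nat) (A : set T)
    (p : T -> 'M[R]_(n, m)) :
  (forall i j, {within A, continuous (fun x => p x i j)}) <->
  {within A, continuous p}.
Proof.
split=> [cp|cp i j].
  apply/subspace_continuousP => x Ax W [P nP sP].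
  have := @filter_forall _ _ (fun ij => [set y | P ij.1 ij.2 (p y ij.1 ij.2)])
    (within A (nbhs x)) _.
  rewrite /prop_near1 /= => H.
  have {}H : within A (nbhs x) [set y | forall ij, P ij.1 ij.2 (p y ij.1 ij.2)].
    apply: H => -[i j] /=.
    by move/subspace_continuousP: (cp i j) => /(_ x Ax); apply; exact: nP.
  by move: H; rewrite /within/=; apply: filterS => y + Ay => /(_ Ay) py;
    apply: sP => i j; exact: (py (i, j)).
by apply: (@within_comp _ _ _ _ setT p (fun M => M i j)) => //;
  apply: continuous_subspaceT; exact: coord_continuous.
Qed.

Section WithinReal.
Variables (R : realType) (T : topologicalType) (A : set T).
Implicit Types f g : T -> R.

Lemma within_cst (c : R) : {within A, continuous (fun=> c)}.
Proof. by apply: continuous_subspaceT => x; exact: cst_continuous. Qed.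

Lemma withinD f g : {within A, continuous f} -> {within A, continuous g} ->
  {within A, continuous (fun x => f x + g x)}.
Proof.
move=> /subspace_continuousP cf /subspace_continuousP cg.
by apply/subspace_continuousP => x Ax; exact: cvgD (cf x Ax) (cg x Ax).
Qed.

Lemma withinB f g : {within A, continuous f} -> {within A, continuous g} ->
  {within A, continuous (fun x => f x - g x)}.
Proof.
move=> /subspace_continuousP cf /subspace_continuousP cg.
by apply/subspace_continuousP => x Ax; exact: cvgB (cf x Ax) (cg x Ax).
Qed.

Lemma withinM f g : {within A, continuous f} -> {within A, continuous g} ->
  {within A, continuous (fun x => f x * g x)}.
Proof.
move=> /subspace_continuousP cf /subspace_continuousP cg.
by apply/subspace_continuousP => x Ax; exact: cvgM (cf x Ax) (cg x Ax).
Qed.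

Lemma within_sum (I : Type) (r : seq I) (P : pred I) (F : I -> T -> R) :
  (forall i, {within A, continuous F i}) ->
  {within A, continuous (fun x => \sum_(i <- r | P i) F i x)}.
Proof.
move=> cF; elim: r => [|i r IHr].
  apply: (@within_eq _ _ _ (fun=> 0)); last exact: within_cst.
  by move=> x _; rewrite big_nil.
have [Pi|Pi] := boolP (P i); last first.
  by apply: within_eq IHr => x _; rewrite big_cons (negbTE Pi).
by apply: within_eq (withinD (cF i) IHr) => x _; rewrite big_cons Pi.
Qed.

Lemma withinV f : (forall x, A x -> f x != 0) -> {within A, continuous f} ->
  {within A, continuous (fun x => (f x)^-1)}.
Proof.
move=> f0 /subspace_continuousP cf.
by apply/subspace_continuousP => x Ax; exact: cvgV (f0 x Ax) (cf x Ax).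
Qed.

Lemma within_min f g : {within A, continuous f} -> {within A, continuous g} ->
  {within A, continuous (fun x => Num.min (f x) (g x))}.
Proof.
move=> cf cg.
rewrite (_ : (fun x => _) =
    fun x => 2^-1 * ((f x + g x) - Num.norm (f x - g x))); last first.
  by apply/funext => x; rewrite Num.Theory.minr_absE mulrC.
apply: withinM; first exact: within_cst.
apply: withinB; first exact: withinD.
apply: (@within_comp _ _ _ _ setT (fun x => f x - g x) Num.norm) => //.
- exact: withinB.
- by apply: continuous_subspaceT => x; exact: norm_continuous.
Qed.

End WithinReal.

(** * Filling maps given on the boundary of a cube *)

Section Fills.
Variables (R : realType) (V : finType).
Implicit Types (X Y : set (V -> R)) (d e : nat).

(* Maps into V -> R are handled through their real coordinates. *)
Definition cts (T : topologicalType) (A : set T) (f : T -> V -> R) :=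
  forall v, {within A, continuous (fun x => f x v)}.

(** The norm on row vectors is the max norm, so these are [[-1, 1]^d] and its boundary. For [d = 0]
    the boundary is empty, so [fills X 0] says that [X] is nonempty. *)
Definition cube d : set 'rV[R]_d := [set x | `|x| <= 1].
Definition bdry d : set 'rV[R]_d := [set x | `|x| = 1].

Arguments cube : clear implicits.
Arguments bdry : clear implicits.

Definition extends_over X d (f : 'rV[R]_d -> V -> R) :=
  exists F, [/\ cts (cube d) F, (forall x, cube d x -> X (F x)) &
    (forall x, bdry d x -> F x = f x)].

Definition fills X d := forall f, cts (bdry d) f ->
  (forall x, bdry d x -> X (f x)) -> extends_over X f.

(* [conn X e] says that X is (e - 2)-connected. *)
Definition conn X e := forall d, (d < e)%N -> fills X d.

Lemma cts_comp (T S : topologicalType) (A : set T) (B : set S)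
    (p : T -> S) (g : S -> V -> R) :
  {within A, continuous p} -> (forall x, A x -> B (p x)) ->
  cts B g -> cts A (fun x => g (p x)).
Proof. by move=> cp pAB cg v; exact (@within_comp _ _ _ _ B p (g ^~ v) cp pAB (cg v)). Qed.

Lemma cts_glue (T : topologicalType) (A B : set T) (f g h : T -> V -> R) :
  closed A -> closed B -> cts A f -> cts B g ->
  (forall x, A x -> h x = f x) -> (forall x, B x -> h x = g x) ->
  cts (A `|` B) h.
Proof.
move=> cA cB cf cg hf hg v.
apply: (@within_glue _ _ A B (f ^~ v) (g ^~ v) (h ^~ v) cA cB (cf v) (cg v)).
- by move=> x Ax; rewrite hf.
- by move=> x Bx; rewrite hg.
Qed.

Lemma cts_sub (T : topologicalType) (A B : set T) (f : T -> V -> R) :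
  A `<=` B -> cts B f -> cts A f.
Proof. by move=> sAB cf v; exact: continuous_subspaceW (cf v). Qed.

Lemma cts_lerp (T : topologicalType) (A : set T) (t : T -> R)
    (f g : T -> V -> R) :
  {within A, continuous t} -> cts A f -> cts A g ->
  cts A (fun x v => (1 - t x) * f x v + t x * g x v).
Proof.
move=> ct cf cg v.
apply: withinD; apply: withinM; [|exact: cf|exact: ct|exact: cg].
by apply: withinB; [exact: within_cst|exact: ct].
Qed.

Lemma within_norm d (A : set 'rV[R]_d) : {within A, continuous (fun x => `|x|)}.
Proof. by apply: continuous_subspaceT => x; exact: norm_continuous. Qed.

Lemma within_normalize d (A : set 'rV[R]_d) :
  (forall x, A x -> `|x| != 0) ->
  {within A, continuous (fun x : 'rV[R]_d => `|x|^-1 *: x)}.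
Proof.
move=> nA; apply/subspace_continuousP => x Ax.
apply: cvg_within_filter.
apply: cvgZ; last exact: cvg_id.
by apply: cvgV; [exact: nA|exact: norm_continuous].
Qed.

(** A filling of [g] is shrunk to the cube of radius 1/2, and the collar around it runs the
    straight-line homotopy from [g] to [f]. *)
Lemma collar X d (f g : 'rV[R]_d -> V -> R) :
  cts (bdry d) f -> cts (bdry d) g ->
  (forall x t, bdry d x -> 0 <= t <= 1 ->
     X (fun v => (1 - t) * f x v + t * g x v)) ->
  extends_over X g -> extends_over X f.
Proof.
move=> cf cg fgX [G [cG XG Gg]].
pose A : set 'rV[R]_d := [set x | `|x| <= 2^-1].
pose B : set 'rV[R]_d := [set x | 2^-1 <= `|x| <= 1].
pose u (x : 'rV[R]_d) := `|x|^-1 *: x.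
have uB x : B x -> bdry d (u x).
  rewrite /B/bdry/u/= => /andP[x1 _].
  have x0 : 0 < `|x| by apply: lt_le_trans x1; rewrite invr_gt0.
  by rewrite normrZ ger0_norm ?invr_ge0// mulVf// gt_eqF.
pose f2 x := fun v => (1 - (2 - 2 * `|x|)) * f (u x) v + (2 - 2 * `|x|) * g (u x) v.
pose F x := if `|x| <= 2^-1 then G (2 *: x) else f2 x.
have A2 x : A x -> cube d (2 *: x).
  by rewrite /A/cube/= normrZ ger0_norm// => x1; lra.
have clA : closed A.
  apply: (@closed_comp _ _ (fun x : 'rV[R]_d => `|x|) [set y | y <= 2^-1]).
    by move=> x _; exact: norm_continuous.
  exact: closed_le.
have clB : closed B.
  rewrite (_ : B = [set x | 2^-1 <= `|x|] `&` [set x | `|x| <= 1]); last first.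
    by apply/seteqP; split=> x; [move/andP|move=> x1; apply/andP].
  apply: closedI.
    apply: (@closed_comp _ _ (fun x : 'rV[R]_d => `|x|) [set y | 2^-1 <= y]).
      by move=> x _; exact: norm_continuous.
    exact: closed_ge.
  apply: (@closed_comp _ _ (fun x : 'rV[R]_d => `|x|) [set y | y <= 1]).
    by move=> x _; exact: norm_continuous.
  exact: closed_le.
have cu : {within B, continuous u}.
  apply: within_normalize => x /andP[x1 _].
  by rewrite gt_eqF//; apply: lt_le_trans x1; rewrite invr_gt0.
exists F; split.
- rewrite (_ : cube d = A `|` B); last first.
    apply/seteqP; split=> x; rewrite /cube/A/B/=.
      by move=> x1; have [|/ltW->] := leP `|x| 2^-1; [left|right].
    by case=> [|/andP[]//]; lra.
  apply: (@cts_glue _ A B (fun x => G (2 *: x)) f2) => //.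
  + apply: (@cts_comp _ _ _ (cube d)) => //.
    by apply: continuous_subspaceT => x; exact: scaler_continuous.
  + apply: cts_lerp.
    * apply: withinB; first exact: within_cst.
      by apply: withinM; [exact: within_cst|exact: within_norm].
    * by apply: (@cts_comp _ _ _ (bdry d)).
    * by apply: (@cts_comp _ _ _ (bdry d)).
  + by move=> x; rewrite /A/F/= => ->.
  + move=> x Bx; rewrite /F; case: ifPn => // x1.
    have {}x1 : `|x| = 2^-1 by apply/eqP; rewrite eq_le x1; case/andP: Bx.
    have xu : 2 *: x = u x by rewrite /u x1 invrK.
    rewrite xu Gg; last exact: uB.
    by apply/funext => v; rewrite /f2 x1 divff ?subrr ?subr0 ?mul1r ?mul0r ?add0r//; lra.
- move=> x x1; rewrite /F; case: ifPn => [/A2/XG//|].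
  rewrite -ltNge => x2; apply: fgX; last by move: x1; rewrite /cube/=; lra.
  by apply: uB; rewrite /B/= (ltW x2).
- move=> x x1; rewrite /F (_ : `|x| <= 2^-1 = false); last first.
    by rewrite x1; apply/negbTE; rewrite -ltNge; lra.
  by apply/funext => v; rewrite /f2 /u x1 invr1 scale1r; lra.
Qed.

End Fills.
Arguments cube : clear implicits.
Arguments bdry : clear implicits.

(** * Extension over the cells of a cubical grid *)

Lemma rV_norm_le (R : realType) d (x : 'rV[R]_d) (r : R) : 0 <= r ->
  (`|x| <= r) <-> (forall i, `|x 0 i| <= r).
Proof.
move=> r0; rewrite /Num.norm /= mx_normrE; split=> [/bigmax_leP[_ H] i|H].
  exact: (H (0, i)).
by apply/bigmax_leP; split=> // -[i j] _ /=; rewrite ord1; exact: H.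
Qed.

Lemma bdryP (R : realType) d (x : 'rV[R]_d) :
  bdry R d x <-> cube R d x /\ exists i, `|x 0 i| = 1.
Proof.
rewrite /bdry /cube /=; split=> [x1|[x1 [i xi]]].
  rewrite x1; split=> //.
  have : mx_norm x != 0 by rewrite -[mx_norm x]/(`|x|) x1 oner_neq0.
  by case/mx_norm_neq0 => -[j i] /= H; exists i; rewrite -x1 -[LHS]/`|x 0 i|
    [RHS]H ord1.
apply/eqP; rewrite eq_le x1 -xi /=.
by have /rV_norm_le := lexx `|x|; apply.
Qed.

Section Grid.
Variables (R : realType) (V : finType) (d N : nat).

(* A cell of the grid cutting [-1, 1]^d into N^d cubes: in the coordinate
   rescaled to [0, N], a code 2a stands for the point a, a code 2a + 1 for the
   interval [a, a + 1]. *)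
Definition code := {ffun 'I_d -> 'I_N.*2.+1}.
Implicit Types (a c : code) (x : 'rV[R]_d) (Z B : {set code}).

Definition scl x i : R := N%:R * (x 0 i + 1) / 2.

Definition cell c : set 'rV[R]_d :=
  [set x | forall i, (c i)./2%:R <= scl x i <= (uphalf (c i))%:R].

Definition dimc c := #|[pred i | odd (c i)]|.

Definition face a c :=
  [forall i, ((c i)./2 <= (a i)./2)%N && (uphalf (a i) <= uphalf (c i))%N].

(** The relative boundary: only directions in which the cell has positive length count, so a grid
    point has an empty one. *)
Definition dcell c : set 'rV[R]_d :=
  [set x | cell c x /\ exists i, odd (c i) /\
     (scl x i = (c i)./2%:R \/ scl x i = (uphalf (c i))%:R)].

Definition supp Z : set 'rV[R]_d := [set x | exists2 c, c \in Z & cell c x].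

Definition face_closed Z := forall a c, c \in Z -> face a c -> a \in Z.

Lemma face_cell a c x : face a c -> cell a x -> cell c x.
Proof.
move=> /forallP ac ax i; have /andP[l u] := ac i; have /andP[l' u'] := ax i.
apply/andP; split; first by apply: le_trans l'; rewrite ler_nat.
by apply: le_trans u' _; rewrite ler_nat.
Qed.

Lemma face_dim a c : face a c -> a != c -> (dimc a < dimc c)%N.
Proof.
move=> /forallP ac nac.
have sub : [pred i | odd (a i)] \subset [pred i | odd (c i)].
  apply/fintype.subsetP => i; rewrite !inE; have /andP[] := ac i.
  move: (nat_of_ord (a i)) (nat_of_ord (c i)) => u w; lia.
suff [i [ci ai]] : exists i, odd (c i) /\ ~~ odd (a i).
  by apply: proper_card; apply/properP; split=> //; exists i; rewrite !inE.
apply: contrapT => H; case/eqP: nac; apply/ffunP => i; apply: val_inj => /=.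
have /andP[] := ac i.
have : odd (c i) -> odd (a i).
  by move=> ci; apply: contraT => ai; case: H; exists i.
by move: (nat_of_ord (a i)) (nat_of_ord (c i)) => u w; lia.
Qed.

Lemma dcell_face c x : dcell c x -> exists a, [/\ face a c, a != c & cell a x].
Proof.
move=> [cx [i [ci e]]].
(* The even code [w] stands for the endpoint at which [x] lies; replacing [c i] by it gives the
   face. *)
have [w [wN wc we wi]] : exists w : nat, [/\ (w < N.*2.+1)%N,
    ~~ odd w, scl x i = w./2%:R & (w./2 = (c i)./2 \/ w./2 = uphalf (c i))%N].
  have := ltn_ord (c i); move: ci e.
  move: (scl x i) (nat_of_ord (c i)) => s u ou [->|->] uN.
    by exists u./2.*2; split; [lia|lia|congr (_%:R); lia|lia].
  by exists (uphalf u).*2; split; [lia|lia|congr (_%:R); lia|lia].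
exists [ffun j => if j == i then Ordinal wN else c j]; split.
- apply/forallP => j; rewrite ffunE; case: eqP => [->|_]; last by rewrite !leqnn.
  by rewrite /=; lia.
- by apply/eqP => /ffunP/(_ i); rewrite ffunE eqxx => H; rewrite -H /= (negbTE wc) in ci.
- move=> j; rewrite ffunE; case: eqP => [->|_]; last exact: cx.
  by rewrite /= we lexx/= ler_nat; lia.
Qed.

(** In some direction the interval of [c] is not contained in that of [a]. Two grid intervals that
    meet without this containment share only an endpoint of the first, which is nondegenerate. *)
Lemma cell_meet a c x : cell c x -> cell a x -> ~~ face c a -> dcell c x.
Proof.
move=> cx ax /forallPn[i nca]; split=> //; exists i.
have := cx i; have := ax i; move: nca.
move: (scl x i) (nat_of_ord (a i)) (nat_of_ord (c i)) => s u w nca.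
move=> /andP[l1 l2] /andP[l3 l4].
have h1 : (u./2 <= uphalf w)%N by rewrite -(ler_nat R); apply: le_trans l4.
have h2 : (w./2 <= uphalf u)%N by rewrite -(ler_nat R); apply: le_trans l2.
have [h|h] : (u./2 = uphalf w /\ odd w)%N \/ (uphalf u = w./2 /\ odd w)%N by lia.
  split; first by case: h.
  by right; apply/eqP; rewrite eq_le l4 -(proj1 h).
split; first by case: h.
by left; apply/eqP; rewrite eq_le l3 -(proj1 h) l2.
Qed.

Lemma within_scl (A : set 'rV[R]_d) i : {within A, continuous (fun x => scl x i)}.
Proof.
apply: withinM; last exact: within_cst.
apply: withinM; first exact: within_cst.
apply: withinD; last exact: within_cst.
by apply: continuous_subspaceT; exact: coord_continuous.
Qed.

Lemma closed_cell c : closed (cell c).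
Proof.
rewrite (_ : cell c = \bigcap_i [set x | (c i)./2%:R <= scl x i] `&`
  \bigcap_i [set x | scl x i <= (uphalf (c i))%:R]); last first.
  apply/seteqP; split=> x; first by move=> H; split=> i _ /=; have /andP[] := H i.
  by move=> [H1 H2] i; apply/andP; split; [exact: H1|exact: H2].
have cs i : continuous (fun x => scl x i).
  by apply/continuous_subspace_setT; exact: within_scl.
apply: closedI; apply: closed_bigI => i _.
  apply: (@preimage_closed _ _ (fun x => scl x i) [set y | _ <= y]).
    by move=> x _; exact: cs.
  exact: closed_ge.
apply: (@preimage_closed _ _ (fun x => scl x i) [set y | y <= _]).
  by move=> x _; exact: cs.
exact: closed_le.
Qed.

Lemma closed_supp Z : closed (supp Z).
Proof.
rewrite (_ : supp Z = \bigcup_(c in [set` Z]) cell c).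
  by apply: closed_bigcup => // c _; exact: closed_cell.
by apply/seteqP; split=> x [c cZ cx]; exists c.
Qed.

Hypothesis N0 : (0 < N)%N.

(** An affine change of coordinates identifies the cell and its relative boundary with the cube of
    dimension [dimc c] and its boundary. *)
Lemma cell_fill (L : set (V -> R)) c f : fills L (dimc c) ->
  cts (dcell c) f -> (forall x, dcell c x -> L (f x)) ->
  exists F, [/\ cts (cell c) F, (forall x, cell c x -> L (F x)) &
    (forall x, dcell c x -> F x = f x)].
Proof.
move=> fL cf Lf; set k := dimc c in fL.
have N0R : (N%:R : R) != 0 by rewrite pnatr_eq0 -lt0n.
pose ev (j : 'I_k) : 'I_d := enum_val j.
have evP j : odd (c (ev j)) by have := enum_valP j; rewrite inE.
have up i : odd (c i) -> (uphalf (c i))%:R = (c i)./2%:R + 1 :> R.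
  by move=> ci; rewrite natr1; congr (_%:R); lia.
(* [p] keeps the odd directions and rescales each unit interval to [[-1, 1]]; [q] is its inverse on
   the cell, and [sq] is [q] in the rescaled coordinates. *)
pose p x : 'rV[R]_k := \row_j (2 * (scl x (ev j) - (c (ev j))./2%:R) - 1).
pose sq (u : 'rV[R]_k) i : R := (c i)./2%:R +
  \sum_(j < k) (ev j == i)%:R * ((u 0 j + 1) / 2).
pose q (u : 'rV[R]_k) : 'rV[R]_d := \row_i (2 * sq u i / N%:R - 1).
have sclq u i : scl (q u) i = sq u i.
  by rewrite /scl mxE; field.
have sqj u j : sq u (ev j) = (c (ev j))./2%:R + (u 0 j + 1) / 2.
  rewrite /sq (bigD1 j)//= eqxx mul1r big1 ?addr0// => j' nj.
  by rewrite (inj_eq enum_val_inj) (negbTE nj) mul0r.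
have sqe u i : ~~ odd (c i) -> sq u i = (c i)./2%:R.
  move=> ci; rewrite /sq big1 ?addr0// => j _.
  by case: eqP => [E|_]; [have := evP j; rewrite E (negbTE ci)|rewrite mul0r].
have oddev i : odd (c i) -> exists j, i = ev j.
  move=> ci; have iS : i \in [pred i | odd (c i)] by rewrite inE.
  by exists (enum_rank_in iS i); rewrite /ev enum_rankK_in.
have qp x : cell c x -> q (p x) = x.
  move=> cx; apply/rowP => i; rewrite mxE.
  have -> : sq (p x) i = scl x i.
    have [/oddev[j ->]|ci] := boolP (odd (c i)).
      by rewrite sqj mxE; field.
    rewrite sqe//; have /andP[l u] := cx i.
    by apply/eqP; rewrite eq_le l/=; apply: le_trans u _; rewrite ler_nat; lia.
  by rewrite /scl; field.
have pcube x : cell c x -> cube R k (p x).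
  move=> cx; apply/rV_norm_le => // j; rewrite mxE ler_norml.
  by have := cx (ev j); rewrite up//; lra.
have qcube u : cube R k u -> cell c (q u).
  move=> /rV_norm_le u1 i; rewrite sclq.
  have [/[dup] ci /oddev[j e]|ci] := boolP (odd (c i)).
    rewrite up// e sqj; have := u1 _ j; rewrite ler_norml => /(_ ler01).
    by lra.
  by rewrite sqe// lexx/= ler_nat; lia.
have pbdry x : dcell c x -> bdry R k (p x).
  move=> [cx [i [/[dup] ci /oddev[j e]]]]; rewrite up// e => H.
  apply/bdryP; split; first exact: pcube.
  exists j; rewrite mxE; case: H => ->; rewrite ?subrr ?mulr0 ?sub0r ?normrN1//.
  by rewrite addrAC subrr add0r mulr1 (_ : 2 - 1 = 1) ?normr1//; lra.
have qbdry u : bdry R k u -> dcell c (q u).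
  move=> /bdryP[cu [j uj]]; split; first exact: qcube.
  exists (ev j); split; first exact: evP.
  rewrite sclq sqj up//; have [u0|u0] := ger0P (u 0 j).
    by right; move: uj; rewrite ger0_norm// => ->; lra.
  by left; move: uj; rewrite ltr0_norm// => uj; lra.
have cp (A : set 'rV[R]_d) : {within A, continuous p}.
  apply/within_mx => i j.
  apply: (@within_eq _ _ _ (fun x => 2 * (scl x (ev j) - (c (ev j))./2%:R) - 1)).
    by move=> x _; rewrite mxE.
  apply: withinB; last exact: within_cst.
  apply: withinM; first exact: within_cst.
  by apply: withinB; [exact: within_scl|exact: within_cst].
have cq (A : set 'rV[R]_k) : {within A, continuous q}.
  apply/within_mx => i0 i.
  apply: (@within_eq _ _ _ (fun u => 2 * sq u i / N%:R - 1)).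
    by move=> x _; rewrite mxE.
  apply: withinB; last exact: within_cst.
  apply: withinM; last exact: within_cst.
  apply: withinM; first exact: within_cst.
  apply: withinD; first exact: within_cst.
  apply: within_sum => j; apply: withinM; first exact: within_cst.
  apply: withinM; last exact: within_cst.
  apply: withinD; last exact: within_cst.
  by apply: continuous_subspaceT; exact: coord_continuous.
have [||F [cF LF Ff]] := fL (fun u => f (q u)).
- exact: (@cts_comp _ _ _ _ _ (dcell c)).
- by move=> u /qbdry/Lf.
exists (fun x => F (p x)); split.
- exact: (@cts_comp _ _ _ _ _ (cube R k)).
- by move=> x /pcube/LF.
- by move=> x /[dup] -[cx _] /pbdry/Ff ->; rewrite qp.
Qed.

(** Induction on the number of cells of [B] outside [Z]. A missing cell of least dimension has all
    its proper faces in [Z], so the map is defined on its boundary and [cell_fill] carries it over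
    the cell. *)
Lemma grid_extend (L : set (V -> R)) Z B f :
  face_closed Z -> face_closed B -> (forall c, c \in B -> fills L (dimc c)) ->
  cts (supp Z) f -> (forall x, supp Z x -> L (f x)) ->
  exists F, [/\ cts (supp (Z :|: B)) F,
    (forall x, supp (Z :|: B) x -> L (F x)) &
    (forall x, supp Z x -> F x = f x)].
Proof.
move=> fZ fB fillB.
have [n] := ubnP #|B :\: Z|; elim: n Z fZ f => // n IHn Z fZ f ltn cf Lf.
have [/eqP|] := set_0Vmem (B :\: Z).
  rewrite finset.setD_eq0 => /finset.setUidPl ->; by exists f; split.
move=> [c0 c0BZ].
have [c cBZ cmin] := @arg_minnP _ c0 (mem (B :\: Z)) dimc c0BZ.
have /finset.setDP[cB ncZ] : c \in B :\: Z := cBZ.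
have facesZ a : face a c -> a != c -> a \in Z.
  move=> ac nac; apply: contraT => naZ.
  have aBZ : a \in B :\: Z by apply/finset.setDP; split=> //; exact: fB ac.
  have := cmin a aBZ.
  by rewrite leqNgt face_dim.
have dcZ x : dcell c x -> supp Z x.
  by move=> /dcell_face[a [ac nac ax]]; exists a => //; exact: facesZ.
(* The new cell meets the old support only in its boundary, because [Z] is closed under faces and
   does not contain it; so the two maps agree where both are defined. *)
have Zdc x : cell c x -> supp Z x -> dcell c x.
  move=> cx [a aZ ax]; apply: (cell_meet cx ax).
  by apply: contra ncZ => /fZ; apply.
have [||F0 [cF0 LF0 F0f]] := @cell_fill L c f (fillB _ cB).
- exact: cts_sub cf.
- by move=> x /dcZ/Lf.
pose f1 x := if `[< supp Z x >] then f x else F0 x.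
have f1Z x : supp Z x -> f1 x = f x by move=> Zx; rewrite /f1 asboolT.
have f1c x : cell c x -> f1 x = F0 x.
  by move=> cx; rewrite /f1; case: asboolP => // Zx; rewrite F0f//; exact: Zdc.
have suppU : supp (c |: Z) = supp Z `|` cell c.
  apply/seteqP; split=> x.
    by move=> [a /setU1P[->|aZ] ax]; [right|left; exists a].
  by move=> [[a aZ ax]|cx]; [exists a|exists c] => //; rewrite !inE ?aZ ?orbT ?eqxx.
have ZB : (c |: Z) :|: B = Z :|: B.
  apply/finset.setP => a; rewrite !finset.in_setU finset.in_set1.
  by have [->|na] := eqVneq a c; rewrite ?cB ?orbT.
have [||||F [cF LF Ff1]] := IHn (c |: Z) _ f1.
- move=> a b /setU1P[->|bZ] ab; apply/setU1P.
    by have [->|nab] := eqVneq a c; [left|right; apply: facesZ].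
  by right; exact: fZ ab.
- rewrite -ltnS; apply: leq_trans ltn; rewrite ltnS; apply: proper_card.
  apply/properP; split.
    by apply/fintype.subsetP => a; rewrite !inE negb_or => /andP[/andP[_ ->] ->].
  by exists c => //; apply/finset.setDP => -[_]; rewrite !inE eqxx.
- rewrite suppU.
  exact: (cts_glue (@closed_supp Z) (@closed_cell c) cf cF0 f1Z f1c).
- rewrite suppU => x [Zx|cx]; first by rewrite f1Z//; exact: Lf.
  by rewrite f1c//; exact: LF0.
exists F; rewrite -ZB; split=> // x Zx.
by rewrite Ff1 ?f1Z// suppU; left.
Qed.

End Grid.

(** * Attaching a cone *)

Lemma compact_bdry (R : realType) d : compact (bdry R d).
Proof.
apply: bounded_closed_compact.
  exists 1; split=> // M M1 x; rewrite /bdry /= => ->; exact: ltW.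
apply: (@preimage_closed _ _ (fun x : 'rV[R]_d => `|x|) [set y | y = 1]).
  by move=> x _; exact: norm_continuous.
exact: closed_eq.
Qed.

(** Uniform continuity on a compact set. The modulus has the form [2 / N] because that is the side
    of a grid cube. *)
Lemma bdry_unif (R : realType) d (s : 'rV[R]_d -> R) (e : R) : 0 < e ->
  {within bdry R d, continuous s} ->
  exists N, (0 < N)%N /\ forall x y, bdry R d x -> bdry R d y ->
    `|x - y| <= 2 / N%:R -> `|s x - s y| < e.
Proof.
move=> e0 /subspace_continuousP cs.
have /compact_near_coveringP/near_covering_withinP ncov := @compact_bdry R d.
pose P (N : nat) (x : 'rV[R]_d) := forall y, bdry R d y ->
  `|x - y| <= 2 / N.+1%:R -> `|s x - s y| < e.
have : \forall N \near \oo, bdry R d `<=` P N.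
  apply: ncov => x bx.
  have e2 : 0 < e / 2 by rewrite divr_gt0.
  have /cvgrPdist_lt/(_ _ e2) := cs x bx.
  rewrite near_withinE => /nbhs_ballP[D /= D0 HD].
  have {}HD y : bdry R d y -> `|x - y| < D -> `|s x - s y| < e / 2.
    by move=> by_ xy; apply: HD => //; rewrite -ball_normE.
  have [N0 HN] : exists N0 : nat, forall N, (N0 <= N)%N -> 2 / N.+1%:R < D / 2.
    exists (Num.truncn (4 / D)) => N NN.
    have : 4 / D < N.+1%:R.
      apply: lt_le_trans (truncnS_gt _) _; by rewrite ler_nat.
    rewrite ltr_pdivrMr// => H.
    by rewrite ltr_pdivrMr//; nra.
  exists ([set y | `|x - y| < D / 2], [set N | (N0 <= N)%N]) => /=.
    split; last by exists N0.
    by apply/nbhs_ballP; exists (D / 2) => /=; [rewrite divr_gt0|rewrite -ball_normE].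
  move=> [z N] /= [xz NN] bz y by_ zy.
  have h1 : `|s x - s z| < e / 2 by apply: HD => //; lra.
  have h2 : `|s x - s y| < e / 2.
    apply: HD => //; apply: le_lt_trans (ler_distD z x y) _.
    by rewrite [D]splitr ltrD// (le_lt_trans zy)// HN.
  have := ler_distD (s x) (s z) (s y); rewrite (distrC (s z) (s x)); lra.
move=> [N _ /(_ N (leqnn _)) HP].
by exists N.+1; split=> // x y /HP; apply.
Qed.

(** * The grid on the boundary of the cube *)

Section GridBoundary.
Variables (R : realType) (d N : nat).

Definition bcell (c : code d N) := [exists i, (c i == 0 :> nat) || (c i == N.*2 :> nat)].

Lemma face_bcell a c : face a c -> bcell c -> bcell a.
Proof.
move=> /forallP ac /existsP[i ci]; apply/existsP; exists i.
have /andP[] := ac i; have := ltn_ord (a i); move: ci.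
by move: (nat_of_ord (a i)) (nat_of_ord (c i)) => u w; lia.
Qed.

Lemma bcell_dim c : bcell c -> (dimc c < d)%N.
Proof.
move=> /existsP[i ci]; rewrite -[X in (_ < X)%N]card_ord /dimc.
apply: proper_card; apply/properP; split; first exact/fintype.subsetP.
by exists i => //; rewrite inE; move: (nat_of_ord (c i)) ci => u; lia.
Qed.

(** A cell of least dimension through [x] is a face of every cell through [x]: otherwise [x] would
    lie on its relative boundary, hence on a face of smaller dimension. *)
Lemma common_face (a b : code d N) (x : 'rV[R]_d) : cell a x -> cell b x ->
  exists c, [/\ face c a, face c b & cell c x].
Proof.
move=> ax bx.
have [c /asboolP cx cmin] := @arg_minnP _ a (fun c => `[< cell c x >]) (@dimc d N)
  (asboolT ax).
have facec e : cell e x -> face c e.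
  move=> ex; apply: contraT => /(cell_meet cx ex)/(dcell_face)[g [gc ngc gx]].
  by have := cmin g (asboolT gx); rewrite leqNgt face_dim.
by exists c; split => //; exact: facec.
Qed.

Hypothesis N0 : (0 < N)%N.

Let N0R : (N%:R : R) != 0. Proof. by rewrite pnatr_eq0 -lt0n. Qed.
Let N0R' : 0 < (N%:R : R). Proof. by rewrite ltr0n. Qed.

Lemma scl_cube (x : 'rV[R]_d) i : (0 <= scl N x i <= N%:R) = (`|x 0 i| <= 1).
Proof.
rewrite /scl ler_norml; apply/idP/idP => /andP[h1 h2].
  apply/andP; split.
    have : 0 <= x 0 i + 1 by rewrite -(pmulr_rge0 _ N0R'); lra.
    by lra.
  have : x 0 i + 1 <= 2 by rewrite -(ler_pM2l N0R'); lra.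
  by lra.
apply/andP; split; first by rewrite divr_ge0// mulr_ge0//; lra.
by rewrite ler_pdivrMr// ler_pM2l//; lra.
Qed.

Lemma bcell_bdry (c : code d N) (x : 'rV[R]_d) : bcell c -> cell c x -> bdry R d x.
Proof.
move=> /existsP[i ci] cx; apply/bdryP; split.
  apply/rV_norm_le => // j; rewrite -scl_cube; have /andP[l u] := cx j.
  rewrite (le_trans _ l) ?ler0n//=; apply: le_trans u _.
  by rewrite ler_nat; have := ltn_ord (c j); lia.
exists i; have /andP[] := cx i.
have sx : x 0 i = 2 * scl N x i / N%:R - 1 by rewrite /scl; field.
case/orP: ci => /eqP -> /=; rewrite ?uphalf_double ?doubleK => l u.
  have s0 : scl N x i = 0 by apply/eqP; rewrite eq_le l u.
  by rewrite sx s0 mulr0 mul0r sub0r normrN1.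
have s0 : scl N x i = N%:R by apply/eqP; rewrite eq_le l u.
by rewrite sx s0 mulfK// (_ : 2 - 1 = 1) ?normr1//; lra.
Qed.

Lemma bdry_bcell (x : 'rV[R]_d) : bdry R d x -> exists2 c : code d N, bcell c & cell c x.
Proof.
move=> /bdryP[/rV_norm_le x1 [i xi]].
have s01 j : 0 <= scl N x j <= N%:R by rewrite scl_cube; apply: x1.
(* The second clause forces the even code at an integral coordinate, so a coordinate [-1] or [1] of
   [x] gets code [0] or [N.*2]. *)
have /choice[c Hc] : forall j, exists c : 'I_N.*2.+1,
    (c./2%:R <= scl N x j <= (uphalf c)%:R) /\
    (forall k : nat, scl N x j = k%:R -> c = k.*2 :> nat).
  move=> j; have /andP[s0 sN] := s01 j.
  have /andP[] := truncn_itv s0; move: (Num.truncn _) => k k1 k2.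
  have kN : (k <= N)%N by rewrite -(ler_nat R); apply: le_trans sN.
  have [sk|sk] := eqVneq (scl N x j) k%:R.
    have kl : (k.*2 < N.*2.+1)%N by lia.
    exists (Ordinal kl); split; first by rewrite /= uphalf_double doubleK sk lexx.
    by move=> k'; rewrite sk => /eqP; rewrite eqr_nat => /eqP e /=; rewrite e.
  have kl : (k.*2.+1 < N.*2.+1)%N.
    suff : (k < N)%N by lia.
    by rewrite -(ltr_nat R); apply: lt_le_trans sN; rewrite lt_neqAle eq_sym sk.
  exists (Ordinal kl); split.
    rewrite /= uphalf_double doubleK k1 /=.
    by apply: ltW; apply: lt_le_trans k2 _; rewrite ler_nat; lia.
  move=> k' sk'; exfalso; move/eqP: sk; apply; rewrite sk'; congr (_%:R).
  by move: k1 k2; rewrite sk' ler_nat ltr_nat; lia.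
exists [ffun j => c j]; last by move=> j; rewrite ffunE; case: (Hc j).
apply/existsP; exists i; rewrite ffunE; have [_ H] := Hc i.
have [x0|x0] := ger0P (x 0 i).
  rewrite (H N) ?eqxx ?orbT//; rewrite /scl -[X in X + 1](ger0_norm x0) xi.
  by rewrite -mulrA divff ?mulr1.
rewrite (H 0%N) ?eqxx// /scl.
have -> : x 0 i = -1 by move: xi; rewrite ltr0_norm// => h; lra.
by rewrite addNr mulr0 mul0r.
Qed.

Lemma cell_dist (c : code d N) (x y : 'rV[R]_d) : cell c x -> cell c y -> `|x - y| <= 2 / N%:R.
Proof.
move=> cx cy; apply/rV_norm_le => [|i]; first by rewrite divr_ge0.
have sx (z : 'rV[R]_d) : z 0 i = 2 * scl N z i / N%:R - 1 by rewrite /scl; field.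
rewrite !mxE (sx x) (sx y).
rewrite [X in Num.norm X](_ : _ = (scl N x i - scl N y i) * (2 / N%:R)); last by field.
rewrite normrM (ger0_norm (_ : 0 <= 2 / N%:R)) ?divr_ge0//.
rewrite -[leRHS]mul1r ler_wpM2r ?divr_ge0//.
have := cx i; have := cy i.
have : (uphalf (c i))%:R <= (c i)./2%:R + 1 :> R by rewrite natr1 ler_nat; lia.
by rewrite ler_norml; lra.
Qed.

End GridBoundary.

Section Cone.
Variables (R : realType) (V : finType).

(** On a grid so fine that [s] varies by less than 1/3 on each cell, every boundary cell lies in
    [s <= 2 / 3] (the family [Q]) or in [1 / 3 <= s] (the family [P]). On the common cells [g] is
    [phi], and it extends over [P] because boundary cells have dimension below [d]. *)
Lemma cover_extend d (L : set (V -> R)) (s : 'rV[R]_d -> R)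
    (phi : 'rV[R]_d -> V -> R) :
  (forall k, (k < d)%N -> fills L k) ->
  {within bdry R d, continuous s} ->
  cts [set x | bdry R d x /\ s x <= 2 / 3] phi ->
  (forall x, bdry R d x -> 1 / 3 <= s x <= 2 / 3 -> L (phi x)) ->
  exists P Q g, [/\ closed P /\ closed Q, bdry R d = P `|` Q,
    (forall x, P x -> 1 / 3 <= s x), (forall x, Q x -> s x <= 2 / 3) &
    [/\ cts P g, (forall x, P x -> L (g x)) &
     (forall x, P x -> Q x -> g x = phi x)]].
Proof.
move=> fL cs cphi Lphi.
have e0 : 0 < (1 / 3 : R) by lra.
have [N [N0 HN]] := bdry_unif e0 cs.
pose P : {set code d N} := finset (fun c => bcell c &&
  `[< forall x : 'rV[R]_d, cell c x -> 1 / 3 <= s x >]).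
pose Q : {set code d N} := finset (fun c => bcell c &&
  `[< forall x : 'rV[R]_d, cell c x -> s x <= 2 / 3 >]).
have fP : face_closed P.
  move=> a c; rewrite !inE => /andP[bc /asboolP Hc] ac.
  rewrite (face_bcell ac bc); apply/asboolP => x ax.
  by apply: Hc; exact: face_cell ax.
have fQ : face_closed Q.
  move=> a c; rewrite !inE => /andP[bc /asboolP Hc] ac.
  rewrite (face_bcell ac bc); apply/asboolP => x ax.
  by apply: Hc; exact: face_cell ax.
have Pb x : supp P x -> bdry R d x.
  by move=> [c]; rewrite inE => /andP[bc _]; exact: bcell_bdry.
have Qb x : supp Q x -> bdry R d x.
  by move=> [c]; rewrite inE => /andP[bc _]; exact: bcell_bdry.
have Ps (x : 'rV[R]_d) : supp P x -> 1 / 3 <= s x.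
  by move=> [c]; rewrite inE => /andP[_ /asboolP Hc] /Hc.
have Qs (x : 'rV[R]_d) : supp Q x -> s x <= 2 / 3.
  by move=> [c]; rewrite inE => /andP[_ /asboolP Hc] /Hc.
have PQs (x : 'rV[R]_d) : supp (P :&: Q) x -> supp P x /\ supp Q x.
  by move=> [c /setIP[cP cQ] cx]; split; exists c.
(* A point of both supports lies in a common face of its two cells, and that face belongs to both
   families. *)
have sPQ (x : 'rV[R]_d) : supp P x -> supp Q x -> supp (P :&: Q) x.
  move=> [a aP ax] [b bQ bx]; have [c [ca cb cx]] := common_face ax bx.
  by exists c => //; apply/setIP; split; [exact: fP ca|exact: fQ cb].
have [|||||g [cg Lg gphi]] := @grid_extend R V d N N0 L (P :&: Q) P phi.
- move=> a c /setIP[cP cQ] ac; apply/setIP; split; [exact: fP ac|exact: fQ ac].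
- exact: fP.
- by move=> c; rewrite inE => /andP[/bcell_dim/fL].
- by apply: cts_sub cphi => x /PQs[xP xQ]; split; [exact: Pb|exact: Qs].
- move=> x /PQs[xP xQ]; apply: Lphi; first exact: Pb.
  by rewrite Ps//= Qs.
rewrite (finset.setUidPr (finset.subsetIl P Q)) in cg Lg.
exists (supp P), (supp Q), g; split=> //.
- by split; exact: closed_supp.
- apply/seteqP; split=> x; last by move=> [/Pb|/Qb].
  move=> /(@bdry_bcell R d N N0)[c bc cx].
  have [H|H] := pselect (forall x : 'rV[R]_d, cell c x -> s x <= 2 / 3).
    by right; exists c => //; rewrite inE bc asboolT.
  left; exists c => //; rewrite inE bc /=; apply/asboolP => y cy.
  move/existsNP: H => [z /not_implyP[cz /negP]]; rewrite -ltNge => sz.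
  have := HN y z (bcell_bdry N0 bc cy) (bcell_bdry N0 bc cz) (cell_dist N0 cy cz).
  by rewrite ltr_norml; lra.
- by split=> // x xP xQ; apply: gphi; exact: sPQ.
Qed.

(* [X] is [X'] with a cone of apex [b] over [L] attached; a point [p] of [X] is
   [(1 - s p) r p + s p b].  The part of the sphere mapped near [b] is pushed
   into [L], which is possible because that part has smaller dimension. *)
Lemma cone_attach d (X X' L : set (V -> R)) (s : (V -> R) -> R)
    (r : (V -> R) -> V -> R) (b : V -> R) :
  (forall (f : 'rV[R]_d -> V -> R) A, cts A f -> {within A, continuous (s \o f)}) ->
  (forall (f : 'rV[R]_d -> V -> R) A, cts A f -> (forall x, A x -> s (f x) < 1) ->
     cts A (r \o f)) ->
  (forall p, X p -> 0 <= s p <= 1) ->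
  (forall p, X p -> s p < 1 ->
     X' (r p) /\ p = (fun v => (1 - s p) * r p v + s p * b v)) ->
  (forall p, X p -> 0 < s p < 1 -> L (r p)) ->
  (forall p, X p -> s p = 1 -> p = b) ->
  (forall q t, L q -> 0 <= t <= 1 -> X (fun v => (1 - t) * q v + t * b v)) ->
  X' `<=` X -> L `<=` X' ->
  fills X' d -> (forall k, (k < d)%N -> fills L k) -> fills X d.
Proof.
move=> cs cr s01 rX' rL s1b coneX X'X LX' fX' fL f cf Xf.
have csf := cs _ _ cf.
have sub3 (x : 'rV[R]_d) : bdry R d x /\ s (f x) <= 2 / 3 -> s (f x) < 1.
  by move=> [_ ?]; lra.
have [||P [Q [g1 [[clP clQ] bPQ Ps Qs [cg1 Lg1 g1r]]]]] :=
    @cover_extend d L (s \o f) (r \o f) fL csf.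
- by apply: cr; [apply: cts_sub cf => x []|exact: sub3].
- by move=> x bx /= sx; apply: rL; [exact: Xf|lra].
have Pb x : P x -> bdry R d x by rewrite bPQ; left.
have Qb x : Q x -> bdry R d x by rewrite bPQ; right.
(* [lam] is 0 where [s] is 0 and 1 from [s = 1 / 3] on, so [m] agrees with [f] where [s] is 0 and
   sends all of [P] to [b]. The homotopies run from [f] to [m] and from [m] to [g], which lies in
   [X']. *)
pose lam x := Num.min 1 (3 * s (f x)).
pose m x := fun v => (1 - lam x) * f x v + lam x * b v.
pose g x := if `[< P x >] then g1 x else r (f x).
have gP x : P x -> g x = g1 x by move=> Px; rewrite /g asboolT.
have gQ x : Q x -> g x = r (f x).
  by move=> Qx; rewrite /g; case: asboolP => // Px; exact: g1r.
have lam01 x : bdry R d x -> 0 <= lam x <= 1.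
  move=> /Xf/s01/andP[h _]; rewrite /lam ge_min lexx /= le_min ler01 /=.
  by rewrite mulr_ge0.
have clam : {within bdry R d, continuous lam}.
  apply: within_min; first exact: within_cst.
  by apply: withinM; [exact: within_cst|exact: csf].
have cb A : cts A (fun _ : 'rV[R]_d => b) by move=> v; exact: within_cst.
have cm : cts (bdry R d) m by exact: cts_lerp.
have cg : cts (bdry R d) g.
  rewrite bPQ; apply: (cts_glue clP clQ cg1 _ gP gQ).
  apply: cr; first by apply: cts_sub cf => x /Qb.
  by move=> x /[dup] /Qb bx /Qs /= sx; exact: sub3.
have X'g x : bdry R d x -> X' (g x).
  rewrite bPQ => -[Px|Qx]; first by rewrite gP//; apply/LX'/Lg1.
  have s1 : s (f x) < 1 by apply: sub3; split; [exact: Qb|exact: Qs].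
  by rewrite gQ//; exact: (rX' _ (Xf _ (Qb _ Qx)) s1).1.
(* A point with [s p = 0] need not lie on the cone, so it may not be moved toward [b]; all others
   may. *)
have push p t : X p -> 0 <= t <= 1 -> (0 < t -> 0 < s p) ->
    X (fun v => (1 - t) * p v + t * b v).
  move=> Xp /andP[t0 t1] st; have [t0'|/st sp] := leP t 0.
    rewrite (_ : (fun v => _) = p)//; apply/funext => v.
    by rewrite (_ : t = 0); [lra|apply/eqP; rewrite eq_le t0'].
  have /andP[_ sp1] := s01 p Xp; have [s1|s1] := ltP (s p) 1; last first.
    have pb : p = b by apply: s1b => //; apply/eqP; rewrite eq_le sp1.
    rewrite (_ : (fun v => _) = p)//; apply/funext => v.
    by rewrite pb; lra.
  have [_ ep] := rX' p Xp s1.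
  rewrite (_ : (fun v => _) = (fun v => (1 - (1 - (1 - t) * (1 - s p))) * r p v +
      (1 - (1 - t) * (1 - s p)) * b v)); last first.
    by apply/funext => v; rewrite {1}ep; ring.
  apply: coneX; first by apply: rL => //; rewrite sp.
  have h1 : 0 <= (1 - t) * (1 - s p) by apply: mulr_ge0; lra.
  have h2 : (1 - t) * (1 - s p) <= 1 by rewrite mulr_ile1//; lra.
  by lra.
(* On [P] the segment joins [b] to a point of [L]. On [Q] it lies on the cone segment through [f x],
   or is constant where [s (f x)] is 0. *)
have mg x t : bdry R d x -> 0 <= t <= 1 ->
    X (fun v => (1 - t) * m x v + t * g x v).
  move=> bx /andP[t0 t1]; move: (bx); rewrite bPQ => -[Px|Qx].
    have l1 : lam x = 1.
      by apply/min_idPl; have := Ps _ Px; rewrite /=; lra.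
    rewrite (_ : (fun v => _) =
        (fun v => (1 - (1 - t)) * g1 x v + (1 - t) * b v)); last first.
      by apply/funext => v; rewrite /m l1 gP//; ring.
    by apply: coneX; [exact: Lg1|lra].
  have s1 : s (f x) < 1 by apply: sub3; split=> //; exact: Qs.
  have [_ ef] := rX' _ (Xf _ bx) s1.
  have /andP[s0 _] := s01 _ (Xf _ bx).
  have [s0'|sp] := leP (s (f x)) 0.
    have se : s (f x) = 0 by apply/eqP; rewrite eq_le s0'.
    have l0 : lam x = 0 by rewrite /lam se mulr0; apply/min_idPr; exact: ler01.
    rewrite (_ : (fun v => _) = f x); first exact: Xf.
    apply/funext => v; rewrite /m l0 gQ//.
    have e : r (f x) v = f x v by have := congr1 (@^~ v) ef; rewrite se /=; lra.
    by rewrite e; ring.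
  have /andP[l0 l1] := lam01 _ bx.
  (* The total weight of [r (f x)] in the combination; the rest is the weight of [b]. *)
  pose c := t + (1 - t) * (1 - lam x) * (1 - s (f x)).
  rewrite (_ : (fun v => _) =
      (fun v => (1 - (1 - c)) * r (f x) v + (1 - c) * b v)); last first.
    by apply/funext => v; rewrite /m gQ// {1}ef /c; ring.
  apply: coneX; first by apply: rL; [exact: Xf|rewrite sp].
  have h1 : 0 <= (1 - lam x) * (1 - s (f x)) by apply: mulr_ge0; lra.
  have h2 : (1 - lam x) * (1 - s (f x)) <= 1 by rewrite mulr_ile1//; lra.
  have h3 : 0 <= (1 - t) * ((1 - lam x) * (1 - s (f x))) by apply: mulr_ge0; lra.
  have h4 : (1 - t) * ((1 - lam x) * (1 - s (f x))) <= 1 - t.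
    by rewrite ler_piMr//; lra.
  by rewrite /c -mulrA; lra.
apply: (collar cf cm).
  move=> x t bx t01; have /andP[l0 l1] := lam01 _ bx; have /andP[t0 t1] := t01.
  rewrite (_ : (fun v => _) =
      (fun v => (1 - t * lam x) * f x v + t * lam x * b v)); last first.
    by apply/funext => v; rewrite /m; ring.
  apply: push; first exact: Xf.
    by rewrite mulr_ge0//= mulr_ile1.
  move=> h; rewrite ltNge; apply/negP => s0; move: h.
  have -> : lam x = 0; last by rewrite mulr0 ltxx.
  have /andP[s0' _] := s01 _ (Xf _ bx).
  have se : s (f x) = 0 by apply/eqP; rewrite eq_le s0.
  by rewrite /lam se mulr0; apply/min_idPr; exact: ler01.
apply: (collar cm cg mg).
have [F [cF XF Fg]] := fX' g cg X'g.
by exists F; split=> // x /XF/X'X.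
Qed.

End Cone.

(** * Geometric realizations *)

Section Complexes.
Variables (R : realType) (V : finType).
Implicit Types (D : {set V} -> bool) (A B S : {set V}) (F : {set {set V}}).

Definition psupp (x : V -> R) : {set V} := finset (fun v => x v != 0).

Definition polyhedron D : set (V -> R) :=
  [set x | [/\ forall v, 0 <= x v, \sum_v x v = 1 & D (psupp x)]].

Definition downset D := forall A B, A \subset B -> D B -> D A.

Definition del S D A := D A && ~~ (S \subset A).
Definition lnk S D A := [disjoint A & S] && D (A :|: S).
(* the join of the boundary of the simplex [S] with its link *)
Definition bdlnk S D A := ~~ (S \subset A) && D (A :|: S).

Lemma conn_le (X : set (V -> R)) e e' : (e' <= e)%N -> conn X e -> conn X e'.
Proof. by move=> ee cX k ke; apply: cX; exact: leq_trans ee. Qed.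

Lemma eq_polyhedron D D' : D =1 D' -> polyhedron D = polyhedron D'.
Proof. by move=> /funext ->. Qed.

Lemma polyhedron_lerp D S (q b : V -> R) (t : R) : downset D -> 0 <= t <= 1 ->
  (forall v, 0 <= q v) -> \sum_v q v = 1 ->
  (forall v, 0 <= b v) -> \sum_v b v = 1 -> (forall v, v \notin S -> b v = 0) ->
  D (psupp q :|: S) -> polyhedron D (fun v => (1 - t) * q v + t * b v).
Proof.
move=> dD /andP[t0 t1] q0 q1 b0 b1 bS Dq; split.
- by move=> v; rewrite addr_ge0// mulr_ge0//; lra.
- by rewrite big_split/= -!mulr_sumr q1 b1; lra.
- apply: dD Dq; apply/fintype.subsetP => v; rewrite !inE.
  have [//|vS] := boolP (v \in S); first by rewrite orbT.
  rewrite (bS _ vS) mulr0 addr0 orbF; apply: contraNneq => ->.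
  by rewrite mulr0.
Qed.

(** The complex is a cone with apex [v0]: straight lines contract every map to that vertex, in all
    dimensions. *)
Lemma cone_conn D v0 e : downset D -> D finset.set0 ->
  (forall A, D A -> D (v0 |: A)) -> conn (polyhedron D) e.
Proof.
move=> dD D0 Dv d _ f cf Xf.
pose b (v : V) : R := (v == v0)%:R.
have b0 v : 0 <= b v by rewrite /b ler0n.
have b1 : \sum_v b v = 1.
  by rewrite (bigD1 v0)//= /b eqxx big1 ?addr0// => v /negbTE ->.
have bS v : v \notin [set v0]%SET -> b v = 0.
  by rewrite inE /b => /negbTE ->.
have cb (K : set 'rV[R]_d) : cts K (fun _ : 'rV[R]_d => b) by move=> v; exact: within_cst.
apply: (collar cf (cb _)).
  move=> x t bx t01; have [f0 f1 Df] := Xf _ bx.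
  by apply: (@polyhedron_lerp D [set v0]%SET) => //; rewrite finset.setUC; exact: Dv.
exists (fun=> b); split=> // x _; split=> //.
apply: dD (Dv _ D0); apply/fintype.subsetP => v; rewrite !inE orbF /b.
by apply: contraR => /negbTE ->.
Qed.

Lemma within_bigmin (T : topologicalType) (A : set T) (r : seq V) (P : pred V)
    (f : T -> V -> R) v0 : cts A f ->
  {within A, continuous (fun x => \big[Num.min/f x v0]_(v <- r | P v) f x v)}.
Proof.
move=> cf; elim: r => [|i r IHr].
  by apply: within_eq (cf v0) => x _; rewrite big_nil.
have [Pi|Pi] := boolP (P i); last first.
  by apply: within_eq IHr => x _; rewrite big_cons (negbTE Pi).
by apply: within_eq (within_min (cf i) IHr) => x _; rewrite big_cons Pi.
Qed.

(** The attached part is a cone over [bdlnk S D] whose apex [b] is the barycentre of [S]. With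
    [mu p] the least coordinate of [p] on [S], [s p] is the weight that can be given to [b];
    removing it and rescaling gives [r p], whose support misses a vertex of [S]. *)
Lemma face_attach D S e : downset D -> S != finset.set0 ->
  conn (polyhedron (del S D)) e -> conn (polyhedron (bdlnk S D)) e.-1 -> conn (polyhedron D) e.
Proof.
move=> dD /set0Pn[v0 v0S] cX' cL d de.
have n0 : (0 < #|S|)%N by apply/card_gt0P; exists v0.
have n0R : (#|S|%:R : R) != 0 by rewrite pnatr_eq0 -lt0n.
pose mu (p : V -> R) := \big[Num.min/p v0]_(v in S) p v.
pose chi (v : V) : R := (v \in S)%:R.
pose s p := #|S|%:R * mu p.
pose r p := fun v => (p v - mu p * chi v) / (1 - s p).
pose b v := chi v / #|S|%:R.
have mule p v : v \in S -> mu p <= p v by move=> vS; exact: bigmin_le_cond.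
have muex p : exists2 v, v \in S & mu p = p v.
  rewrite /mu; elim/big_rec: _ => [|v x vS [w wS ->]]; first by exists v0.
  by rewrite minEle; case: ifP => _; [exists v|exists w].
have mu0 p : (forall v, 0 <= p v) -> 0 <= mu p.
  by move=> p0; have [v _ ->] := muex p.
have schi : \sum_v chi v = #|S|%:R.
  rewrite /chi -natr_sum; congr (_%:R); rewrite -sum1_card [RHS]big_mkcond /=.
  by apply: eq_bigr => v _; case: (v \in S).
have pchi p v : (forall v, 0 <= p v) -> 0 <= p v - mu p * chi v.
  move=> p0; rewrite /chi; case: (boolP (v \in S)) => vS.
    by rewrite mulr1 subr_ge0 mule.
  by rewrite mulr0 subr0.
have ssum p : \sum_v (p v - mu p * chi v) = \sum_v p v - s p.
  by rewrite sumrB -mulr_sumr schi mulrC.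
have s01 p : polyhedron D p -> 0 <= s p <= 1.
  move=> [p0 p1 _]; apply/andP; split; first by rewrite /s mulr_ge0 ?mu0.
  by rewrite -subr_ge0 -p1 -ssum sumr_ge0// => v _; exact: pchi.
have rP p : polyhedron D p -> s p < 1 ->
    [/\ forall v, 0 <= r p v, \sum_v r p v = 1,
        psupp (r p) \subset psupp p & ~~ (S \subset psupp (r p))].
  move=> [p0 p1 Dp] s1; have s1' : 0 < 1 - s p by rewrite subr_gt0.
  split.
  - by move=> v; rewrite /r divr_ge0 ?pchi// ltW.
  - by rewrite /r -mulr_suml ssum p1 divff// gt_eqF.
  - apply/fintype.subsetP => v; rewrite !inE; apply: contraNneq => pv.
    have : 0 <= p v - mu p * chi v by exact: pchi.
    rewrite /r pv sub0r oppr_ge0 => h.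
    have -> : mu p * chi v = 0.
      by apply/eqP; rewrite eq_le h mulr_ge0 ?mu0 /chi ?ler0n.
    by rewrite oppr0 mul0r.
  - have [v vS e1] := muex p; apply/negP => /fintype.subsetP/(_ v vS).
    by rewrite !inE /r /chi vS mulr1 e1 subrr mul0r eqxx.
have b0 v : 0 <= b v by rewrite divr_ge0 ?ler0n.
have b1 : \sum_v b v = 1 by rewrite -mulr_suml schi divff.
have bS v : v \notin S -> b v = 0 by rewrite /b /chi => /negbTE ->; rewrite mul0r.
apply: (@cone_attach R V d (polyhedron D) (polyhedron (del S D)) (polyhedron (bdlnk S D)) s r b).
- move=> f A cf; apply: withinM; first exact: within_cst.
  exact: within_bigmin.
- move=> f A cf s1 v; apply: withinM.
    apply: withinB; first exact: cf.
    by apply: withinM; [exact: within_bigmin|exact: within_cst].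
  apply: withinV; first by move=> x /s1 h; rewrite gt_eqF// subr_gt0.
  apply: withinB; first exact: within_cst.
  by apply: withinM; [exact: within_cst|exact: within_bigmin].
- exact: s01.
- move=> p Xp s1; have [r0 r1 rS nS] := rP p Xp s1; have [p0 p1 Dp] := Xp.
  split; first by split=> //; rewrite /del nS andbT; exact: dD Dp.
  apply/funext => v; rewrite /r /b mulrCA divff ?mulr1; last first.
    by rewrite gt_eqF// subr_gt0.
  by rewrite /s; field.
- move=> p Xp /andP[s0 s1]; have [r0 r1 rS nS] := rP p Xp s1; have [p0 p1 Dp] := Xp.
  split=> //; rewrite /bdlnk nS /=; apply: dD Dp.
  apply/fintype.subsetP => v /finset.setUP[/(fintype.subsetP rS)//|vS].
  rewrite inE gt_eqF//; apply: lt_le_trans (mule p _ vS).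
  by move: s0; rewrite /s pmulr_rgt0// ltr0n.
- move=> p [p0 p1 Dp] s1; apply/funext => v.
  (* The nonnegative remainder sums to 0, so [p] is [mu p] on [S] and 0 elsewhere: the
     barycentre. *)
  have : \sum_v (p v - mu p * chi v) = 0 by rewrite ssum p1 s1 subrr.
  move/psumr_eq0P => /(_ (fun w _ => pchi p w p0) v isT) /eqP.
  rewrite subr_eq0 => /eqP ->; rewrite /b.
  have -> : mu p = #|S|%:R^-1; last by rewrite mulrC.
  by apply: (mulfI n0R); rewrite divff.
- move=> q t [q0 q1 /andP[_ Dq]] t01.
  exact: (@polyhedron_lerp D S).
- by move=> p [p0 p1 /andP[]].
- move=> p [p0 p1 /andP[nS Dp]]; split=> //; rewrite /del nS andbT.
  by apply: dD Dp; exact: finset.subsetUl.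
- exact: cX'.
- by move=> k kd; apply: cL; lia.
Qed.

Lemma downset_del S D : downset D -> downset (del S D).
Proof.
move=> dD A B AB /andP[/(dD _ _ AB) DA nS]; rewrite /del DA /=.
by apply: contra nS => /fintype.subset_trans; apply.
Qed.

Lemma downset_bdlnk S D : downset D -> downset (bdlnk S D).
Proof.
move=> dD A B AB /andP[nS DA]; apply/andP; split.
  by apply: contra nS => /fintype.subset_trans; apply.
by apply: dD DA; exact: finset.setSU.
Qed.

(** Each vertex of [S] after the first adds one degree, as in a suspension. For distinct [v] and [w]
    in [S], deleting [v] leaves a cone with apex [w], and putting [v] back calls for the same
    statement about [S :\ v] in the link of [v]. *)
Lemma bdlnk_conn S D e : downset D -> D S -> S != finset.set0 ->
  conn (polyhedron (lnk S D)) e -> conn (polyhedron (bdlnk S D)) (e + #|S|.-1).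
Proof.
have [n] := ubnP #|S|; elim: n S D => // n IHn S D ltn dD DS /set0Pn[v vS] cL.
have [/eqP S1|S1] := boolP (S :\ v == finset.set0).
  (* The boundary of a single vertex is empty, so only the link remains. *)
  have Sv : S = [set v]%SET by rewrite -(finset.setD1K vS) S1 finset.setU0.
  rewrite Sv cards1 addn0; rewrite Sv in cL.
  rewrite (_ : polyhedron (bdlnk _ _) = polyhedron (lnk [set v]%SET D))//.
  apply: eq_polyhedron => A.
  by rewrite /bdlnk /lnk finset.sub1set disjoint_sym disjoints1.
have cS : #|S| = #|S :\ v|.+1 by rewrite (cardsD1 v S) vS.
have [w wSv] := set0Pn _ S1; have /setD1P[wv wS] := wSv.
apply: (@face_attach _ [set v]%SET).
- exact: downset_bdlnk.
- by apply/set0Pn; exists v; rewrite inE.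
- apply: (@cone_conn _ w).
  + exact/downset_del/downset_bdlnk.
  + rewrite /del /bdlnk finset.set0U DS finset.sub1set inE !andbT.
    by apply/negP => /fintype.subsetP/(_ v vS); rewrite inE.
  + move=> A /andP[/andP[_ DA]]; rewrite /del /bdlnk finset.sub1set => vA.
    have vwA : v \notin w |: A by rewrite !inE negb_or eq_sym wv.
    rewrite finset.sub1set vwA andbT; apply/andP; split.
      by apply: contra vwA => /fintype.subsetP; apply.
    rewrite (_ : (w |: A) :|: S = A :|: S)//; apply/finset.setP => u; rewrite !inE.
    by have [->|uw] := eqVneq u w; rewrite ?wS ?orbT.
(* [D2] is the link of [v] in [D]; the link of [S :\ v] in it is the link of [S] in [D]. *)
- pose D2 A := (v \notin A) && D (v |: A).
  have e1 A : v |: (A :|: (S :\ v)) = A :|: S.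
    by rewrite finset.setUCA finset.setD1K.
  have -> : (e + #|S|.-1).-1 = (e + #|S :\ v|.-1)%N.
    have : (0 < #|S :\ v|)%N by apply/card_gt0P; exists w.
    by rewrite cS; lia.
  rewrite (_ : polyhedron _ = polyhedron (bdlnk (S :\ v) D2)); last first.
    apply: eq_polyhedron => A; rewrite /bdlnk /D2 e1 finset.sub1set.
    rewrite !inE eqxx /= orbF.
    rewrite (_ : (A :|: [set v]%SET) :|: S = A :|: S); last first.
      apply/finset.setP => u; rewrite !inE -orbA.
      by have [->|uv] := eqVneq u v; rewrite ?vS.
    rewrite (finset.setUC A [set v]%SET).
    rewrite (_ : (S \subset v |: A) = (S :\ v \subset A)); last by rewrite finset.subDset.
    by case: (v \in A); rewrite /= ?andbF ?andbT.
  apply: IHn.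
  + by rewrite -ltnS -cS.
  + move=> A B AB /andP[vB DB]; apply/andP; split.
      by apply: contra vB => /(fintype.subsetP AB).
    by apply: dD DB; exact: finset.setUS.
  + by rewrite /D2 finset.setD1K// DS !inE eqxx.
  + exact: S1.
  + rewrite (_ : polyhedron _ = polyhedron (lnk S D))//; apply: eq_polyhedron => A.
    rewrite /lnk /D2 e1 andbA !inE eqxx /= orbF; congr (_ && _).
    by rewrite -[in RHS](finset.setD1K vS) -!finset.setI_eq0 finset.setIUr finset.setU_eq0
      !finset.setI_eq0 (disjoint_sym A [set v]%SET) disjoints1 andbC.
Qed.

(** The boundary of [S] supplies [#|S| - 1] degrees and the base of the cone needs one less than
    [e], so [e - #|S|] suffices for the link, also when the subtraction truncates. *)
Lemma face_add D S e : downset D -> D S -> S != finset.set0 ->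
  conn (polyhedron (del S D)) e -> conn (polyhedron (lnk S D)) (e - #|S|) ->
  conn (polyhedron D) e.
Proof.
move=> dD DS S0 cd cl; apply: (@face_attach _ S) => //.
apply: conn_le (bdlnk_conn dD DS S0 cl).
have : (0 < #|S|)%N by rewrite card_gt0.
by lia.
Qed.

(** The faces are attached one at a time. As they are pairwise incompatible, deleting one does not
    change the link of another. *)
Lemma faces_add F D e : downset D ->
  (forall S, S \in F -> S != finset.set0) ->
  (forall S S', S \in F -> S' \in F -> S != S' -> ~~ D (S :|: S')) ->
  (forall S, S \in F -> D S -> conn (polyhedron (lnk S D)) (e - #|S|)) ->
  conn (polyhedron (fun A => D A && [forall S in F, ~~ (S \subset A)])) e ->
  conn (polyhedron D) e.
Proof.
have [n] := ubnP #|F|; elim: n F D => // n IHn F D ltn dD F0 FF cl cD.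
have [F_0|[S SF]] := set_0Vmem F.
  rewrite (_ : polyhedron D = polyhedron (fun A => D A && [forall S in F, ~~ (S \subset A)]))//.
  apply: eq_polyhedron => A; rewrite (_ : [forall S in F, _]) ?andbT//.
  by apply/forall_inP => S; rewrite F_0 inE.
have cdel : conn (polyhedron (del S D)) e.
  apply: (IHn (F :\ S)).
  - by move: ltn; rewrite (cardsD1 S F) SF.
  - exact: downset_del.
  - by move=> T /setD1P[_ /F0].
  - move=> T T' /setD1P[_ TF] /setD1P[_ TF'] TT'.
    by rewrite /del (negbTE (FF _ _ TF TF' TT')).
  - move=> T /setD1P[TS TF] /andP[DT _].
    rewrite (_ : polyhedron _ = polyhedron (lnk T D)); first exact: cl.
    apply: eq_polyhedron => A; rewrite /lnk /del; congr (_ && _).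
    have [DA|//] := boolP (D (A :|: T)); rewrite /=.
    apply: contra (FF _ _ TF SF TS) => SA; apply: dD DA.
    by rewrite finset.subUset SA finset.subsetUr.
  - rewrite (_ : polyhedron _ = polyhedron (fun A => D A && [forall S in F, ~~ (S \subset A)]))//.
    apply: eq_polyhedron => A; rewrite /del -andbA; congr (_ && _).
    apply/andP/forall_inP => [[nS /forall_inP H] T TF|H].
      by have [->//|TS] := eqVneq T S; apply: H; apply/setD1P.
    split; first exact: H.
    by apply/forall_inP => T /setD1P[_ /H].
have [DS|DS] := boolP (D S).
  by apply: (@face_add _ S) => //; [exact: F0|exact: cl].
rewrite (_ : polyhedron D = polyhedron (del S D))//; apply: eq_polyhedron => A.
rewrite /del; have [DA|//] := boolP (D A); rewrite /=; symmetry.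
by apply: contra DS => /dD; apply.
Qed.

End Complexes.
Arguments polyhedron R {V} D _.

(** * Rook complexes *)

Section Counting.
Variables (V I : finType) (p : V -> I).
Implicit Types (A B T W : {set V}) (i : I) (h : I -> nat).

(** [p] will be the projection to rows or to columns, so that both are treated at once. *)
Definition cnt A i := (\sum_(c in A) (p c == i))%N.

Lemma cntE A i : cnt A i = #|finset (fun c => (c \in A) && (p c == i))|.
Proof.
rewrite /cnt -sum1_card big_mkcond [RHS]big_mkcond /=.
by apply: eq_bigr => c _; rewrite inE; case: (c \in A); case: (p c == i).
Qed.

Lemma cntS A B i : A \subset B -> (cnt A i <= cnt B i)%N.
Proof.
move=> AB; rewrite !cntE; apply/subset_leq_card/fintype.subsetP => c.
by rewrite !inE => /andP[/(fintype.subsetP AB) -> ->].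
Qed.

Lemma cntU A B i : [disjoint A & B]%B -> cnt (A :|: B) i = (cnt A i + cnt B i)%N.
Proof. by move=> dAB; rewrite /cnt -bigU//=; apply: eq_bigl => c; rewrite !inE. Qed.

Lemma sum_cnt A : (\sum_i cnt A i)%N = #|A|.
Proof.
rewrite exchange_big /= -sum1_card; apply: eq_bigr => c _.
by rewrite (bigD1 (p c))//= eqxx big1 ?addn0// => i; rewrite eq_sym => /negbTE ->.
Qed.

Lemma cnt_fiber A i0 i : (forall c, c \in A -> p c = i0) ->
  cnt A i = if i == i0 then #|A| else 0%N.
Proof.
move=> Ai; rewrite /cnt; case: eqP => [->|/eqP ni].
  by rewrite -sum1_card; apply: eq_bigr => c /Ai ->; rewrite eqxx.
by rewrite big1// => c /Ai ->; rewrite eq_sym (negbTE ni).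
Qed.

Lemma cnt0 A c : cnt A (p c) = 0%N -> c \notin A.
Proof.
move=> A0; apply/negP => cA; move: A0.
by rewrite /cnt (bigD1 c)//= eqxx.
Qed.

Definition bounded_by h A := [forall i, cnt A i <= h i]%N.

Lemma bounded_byS h A B : A \subset B -> bounded_by h B -> bounded_by h A.
Proof.
move=> AB /forallP hB; apply/forallP => i.
exact: leq_trans (cntS i AB) (hB i).
Qed.

(* the faces in the fiber of [v0], away from [v0], that leave no room for [v0] *)
Definition blockers h v0 : {set {set V}} :=
  finset (fun T => [forall c in T, (p c == p v0) && (c != v0)] && (#|T| == h (p v0))).

Lemma blockersP h v0 T : reflect [/\ forall c, c \in T -> p c = p v0,
  v0 \notin T & #|T| = h (p v0)] (T \in blockers h v0).
Proof.
rewrite inE; apply: (iffP andP) => [[/forall_inP H /eqP e]|[H v0T /eqP e]].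
  split=> // [c /H/andP[/eqP//]|]; apply/negP => /H/andP[_].
  by rewrite eqxx.
split=> //; apply/forall_inP => c cT; rewrite (H _ cT) eqxx /=.
by apply: contraNneq v0T => <-.
Qed.

Lemma subset_of_card A n : (n <= #|A|)%N -> exists2 B : {set V}, B \subset A & #|B| = n.
Proof.
move=> nA; exists (finset (fun c => c \in take n (enum A))).
  by apply/fintype.subsetP => c; rewrite inE => /mem_take; rewrite mem_enum.
have -> : #|finset (fun c => c \in take n (enum A))| = #|take n (enum A)|.
  by apply: eq_card => c; rewrite inE.
by rewrite (card_uniqP _) ?take_uniq ?enum_uniq// size_takel// -cardE.
Qed.

(** [v0] does not fit exactly when its line already holds at least the full capacity in cells of [A]
    other than [v0], and these then contain a blocker. *)
Lemma no_blockers h v0 A : bounded_by h A ->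
  [forall T in blockers h v0, ~~ (T \subset A)] = bounded_by h (v0 |: A).
Proof.
move=> /forallP hA.
have dv0 : [disjoint [set v0]%SET & A :\ v0]%B.
  by rewrite disjoints1 !inE eqxx.
have cv0 i : cnt (v0 |: A) i = ((i == p v0) + cnt (A :\ v0) i)%N.
  rewrite (_ : v0 |: A = v0 |: (A :\ v0)); last first.
    by apply/finset.setP => c; rewrite !inE; case: (eqVneq c v0).
  by rewrite cntU// (@cnt_fiber _ (p v0)) ?cards1// => c /finset.set1P ->.
apply/forall_inP/forallP => [H i|H T /blockersP[Tp v0T Tc]].
  rewrite cv0; case: eqP => [->|_]; last first.
    by rewrite add0n (leq_trans _ (hA i))// cntS// finset.subsetDl.
  rewrite add1n ltnNge; apply/negP; rewrite cntE => /subset_of_card[T sT cT].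
  have TA c : c \in T -> [/\ c \in A, p c = p v0 & c != v0].
    by move/(fintype.subsetP sT); rewrite !inE => /andP[/andP[? ?] /eqP].
  have /H/negP : T \in blockers h v0.
    apply/blockersP; split=> // [c /TA[]//|]; apply/negP => /TA[_ _].
    by rewrite eqxx.
  by apply; apply/fintype.subsetP => c /TA[].
apply/negP => TA; have := H (p v0); rewrite cv0 eqxx -Tc.
have <- : cnt T (p v0) = #|T| by rewrite (cnt_fiber _ Tp) eqxx.
rewrite add1n ltnNge cntS//; apply/fintype.subsetP => c cT.
rewrite !inE (fintype.subsetP TA _ cT) andbT.
by apply: contraNneq v0T => <-.
Qed.

(** Both fill the line of [v0] to capacity; a union within the capacity is no larger than either,
    hence equals both. *)
Lemma blockers_incompatible h v0 T T' : T \in blockers h v0 ->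
  T' \in blockers h v0 -> T != T' -> ~~ bounded_by h (T :|: T').
Proof.
move=> /blockersP[Tp _ Tc] /blockersP[Tp' _ Tc']; apply: contra => /forallP/(_ (p v0)).
rewrite (@cnt_fiber _ (p v0)) => [|c /finset.setUP[/Tp|/Tp']//]; rewrite eqxx => H.
have e1 : T = T :|: T'.
  by apply/eqP; rewrite eqEcard finset.subsetUl Tc.
have e2 : T' = T :|: T'.
  by apply/eqP; rewrite eqEcard finset.subsetUr Tc'.
by rewrite e2 -e1.
Qed.

End Counting.

(** [T] exhausts the line of [v0], so faces of the link avoid that line and with it [W :|: T], whose
    cells use up capacity in the other direction. [W] will be [v0] alone for row blockers and empty
    for column blockers. *)
Lemma link_blocker (V I J : finType) (p : V -> I) (q : V -> J) (h : I -> nat)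
    (g : J -> nat) (v0 : V) (W T : {set V}) :
  T \in blockers p h v0 -> (forall c, c \in W -> p c = p v0) ->
  [disjoint W & T]%B -> bounded_by q g (W :|: T) ->
  lnk T (fun A => bounded_by p h A && bounded_by q g (W :|: A)) =1
  (fun A => bounded_by p (fun i => if i == p v0 then 0%N else h i) A &&
            bounded_by q (fun j => (g j - cnt q (W :|: T) j)%N) A).
Proof.
move=> /blockersP[Tp v0T Tc] Wp dWT /forallP gWT A; rewrite /lnk.
have cT i : cnt p T i = if i == p v0 then h i else 0%N.
  by rewrite (cnt_fiber _ Tp) Tc; case: eqP => // ->.
apply/andP/andP => [[dAT /andP[/forallP hA /forallP gA]]|[/forallP hA /forallP gA]].
  have hA' : forall i, (cnt p A i <= if i == p v0 then 0 else h i)%N.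
    by move=> i; have := hA i; rewrite cntU// cT; case: eqP => _; lia.
  have A0 c : p c = p v0 -> c \notin A.
    move=> pc; apply: (@cnt0 _ _ p); apply/eqP.
    by rewrite -leqn0; have := hA' (p c); rewrite pc eqxx.
  have dAW : [disjoint A & W :|: T]%B.
    apply/pred0P => c /=; apply/negP => /andP[cA /finset.setUP[/Wp|/Tp] /A0];
      by rewrite cA.
  split; first exact/forallP.
  apply/forallP => j; have := gA j.
  by rewrite finset.setUCA cntU//; lia.
have A0 c : p c = p v0 -> c \notin A.
  move=> pc; apply: (@cnt0 _ _ p); apply/eqP.
  by rewrite -leqn0; have := hA (p c); rewrite pc eqxx.
have dAW : [disjoint A & W :|: T]%B.
  apply/pred0P => c /=; apply/negP => /andP[cA /finset.setUP[/Wp|/Tp] /A0];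
    by rewrite cA.
have dAT : [disjoint A & T]%B.
  by apply: disjointWr dAW; exact: finset.subsetUr.
split=> //; apply/andP; split; apply/forallP => i.
  by rewrite cntU// cT; have := hA i; case: eqP => _; lia.
by rewrite finset.setUCA cntU//; have := gA i; have := gWT i; lia.
Qed.

Section Rook.
Variables (R : realType) (n m : nat).
Local Notation V := ('I_n * 'I_m)%type.
Implicit Types (k : 'I_n -> nat) (l : 'I_m -> nat).

Definition rook k l (A : {set V}) := bounded_by fst k A && bounded_by snd l A.

Lemma rook_faceE k l : rook_face n m k l =1 rook k l.
Proof.
move=> A; rewrite /rook_face /rook /bounded_by; congr (_ && _);
  by apply: eq_forallb => i; rewrite cntE; congr (_ <= _)%N; apply: eq_card => c;
     rewrite !inE.
Qed.

Lemma downset_rook k l : downset (rook k l).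
Proof. by move=> A B AB /andP[/(bounded_byS AB) ? /(bounded_byS AB) ?]; apply/andP. Qed.

Lemma sum_sub_cnt (I : finType) (q : V -> I) (g : I -> nat) (A : {set V}) :
  bounded_by q g A ->
  (\sum_i (g i - cnt q A i) = \sum_i g i - #|A| /\ #|A| <= \sum_i g i)%N.
Proof.
move=> /forallP H; rewrite -(sum_cnt q A) sumnB//; split=> //.
by apply: leq_sum.
Qed.

Lemma sum_zero_at (I : finType) (g : I -> nat) i0 :
  (\sum_i g i = g i0 + \sum_i (if i == i0 then 0 else g i))%N.
Proof.
rewrite (bigD1 i0)//= [in RHS](bigD1 i0)//= eqxx add0n; congr (_ + _)%N.
by apply: eq_bigr => i /negbTE ->.
Qed.

(* [S] contains the rows that are still in play. *)
Lemma rook_conn (S : {set 'I_n}) k l : (forall i, i \notin S -> k i = 0%N) ->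
  (\sum_i k i + #|S| <= \sum_j l j + 1)%N ->
  conn (polyhedron R (rook k l)) (\sum_i k i).
Proof.
(* Links of row blockers lose a row and some column capacity, links of column blockers lose a
   column; this sum drops in both cases. *)
have [N] := ubnP (#|S| + \sum_j l j)%N; elim: N S k l => // N IHN S k l ltN kS kl.
have [k0|] := posnP (\sum_i k i)%N; first by rewrite k0.
rewrite lt0n sum_nat_eq0 => /forallPn[i0]; rewrite /= -lt0n => ki0.
have i0S : i0 \in S by apply: contraTT ki0 => /kS ->.
have S0 : (0 < #|S|)%N by apply/card_gt0P; exists i0.
have K0 : (k i0 <= \sum_i k i)%N by rewrite (bigD1 i0)//= leq_addr.
have : (\sum_j l j != 0)%N by lia.
rewrite sum_nat_eq0 => /forallPn[j0]; rewrite /= -lt0n => lj0.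
pose v0 : V := (i0, j0).
(* The intermediate stage, the star of [v0] with the row blockers attached: [v0] must still fit into
   its column, but not into its row. *)
pose X1 (A : {set V}) := bounded_by fst k A && bounded_by snd l (v0 |: A).
have dX1 : downset X1.
  move=> A B AB /andP[/(bounded_byS AB) hA hB]; rewrite /X1 hA /=.
  by apply: bounded_byS hB; exact: finset.setUS.
have cX0 : conn (polyhedron R (fun A => rook k l (v0 |: A))) (\sum_i k i).
  apply: (@cone_conn _ _ _ v0).
  - by move=> A B AB; apply: downset_rook; exact: finset.setUS.
  - rewrite finset.setU0; apply/andP; split; apply/forallP => i.
      rewrite (@cnt_fiber _ _ _ _ i0) ?cards1; last by move=> c /finset.set1P ->.
      by case: eqP => // ->.
    rewrite (@cnt_fiber _ _ _ _ j0) ?cards1; last by move=> c /finset.set1P ->.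
    by case: eqP => // ->.
  - by move=> A; rewrite finset.setUA finset.setUid.
have cX1 : conn (polyhedron R X1) (\sum_i k i).
  apply: (@faces_add _ _ (blockers fst k v0)) => //.
  - move=> T /blockersP[_ _ Tc]; rewrite -card_gt0 Tc; exact: ki0.
  - move=> T T' HT HT' TT'; rewrite /X1.
    by rewrite (negbTE (blockers_incompatible HT HT' TT')).
  - move=> T HT /andP[_ gT]; have [Tp v0T Tc] := blockersP _ _ _ _ HT.
    rewrite (_ : polyhedron R _ = polyhedron R (rook (fun i => if i == i0 then 0%N else k i)
      (fun j => (l j - cnt snd (v0 |: T) j)%N))); last first.
      apply/eq_polyhedron/(link_blocker HT) => //; first by move=> c /finset.set1P ->.
      by rewrite disjoints1.
    have := sum_zero_at k i0; have [] := sum_sub_cnt gT.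
    rewrite cardsU1 v0T Tc /= => h1 h2 h3.
    rewrite [X in conn _ X](_ : _ = \sum_i (if i == i0 then 0 else k i))%N; last first.
      by rewrite h3 addKn.
    have cS : #|S| = #|S :\ i0|.+1 by rewrite (cardsD1 i0 S) i0S.
    apply: (IHN (S :\ i0)).
    + by rewrite h1; move: h2 ltN cS; rewrite /=; lia.
    + move=> i; rewrite !inE negb_and negbK; case: eqP => //= _.
      exact: kS.
    (* Row capacity drops by [k i0], the number of rows by 1 and column capacity by [k i0 + 1], so
       the inequality persists. *)
    + set K' := (X in (X + _)%N); set L' := (\sum_j l j)%N in ltN kl.
      have {}h3 : (\sum_i k i = k i0 + K')%N by exact: h3.
      have {}h2 : (1 + k i0 <= L')%N by exact: h2.
      by rewrite h1 -/L'; lia.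
  - rewrite (_ : polyhedron R _ = polyhedron R (fun A => rook k l (v0 |: A)))//.
    apply: eq_polyhedron => A; rewrite /X1 /rook.
    have [hA|hA] := boolP (bounded_by fst k A); last first.
      apply/esym/negbTE; apply: contra hA => /andP[+ _].
      by apply: bounded_byS; exact: finset.subsetUr.
    by rewrite (no_blockers _ hA) /= andbC.
apply: (@faces_add _ _ (blockers snd l v0)).
- exact: downset_rook.
- move=> T /blockersP[_ _ Tc]; rewrite -card_gt0 Tc; exact: lj0.
- move=> T T' HT HT' TT'; rewrite /rook.
  by rewrite (negbTE (blockers_incompatible HT HT' TT')) andbF.
- move=> T HT /andP[gT _]; have [Tp v0T Tc] := blockersP _ _ _ _ HT.
  rewrite (_ : polyhedron R _ = polyhedron R (rook (fun i => (k i - cnt fst T i)%N)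
    (fun j => if j == j0 then 0%N else l j))); last first.
    apply: eq_polyhedron => A; rewrite /rook andbC.
    have := @link_blocker _ _ _ snd fst l k v0 finset.set0 T HT.
    rewrite finset.set0U => <-//.
    + by rewrite /lnk /rook finset.set0U [X in _ && X = _]andbC.
    + by move=> c; rewrite inE.
    + by rewrite -finset.setI_eq0 finset.set0I.
  have := sum_zero_at l j0; have [] := sum_sub_cnt gT.
  rewrite Tc /= => h1 h2 h3; rewrite -h1.
  apply: (IHN S).
  + set L' := (X in (_ + X < _)%N); have {}h3 : (\sum_j l j = l j0 + L')%N by exact: h3.
    by lia.
  + by move=> i /kS ->.
  (* Both capacities drop by [l j0] while [S] stays the same. *)
  + set K' := (\sum_i k i)%N in kl h1 h2 *; set L' := (X in (_ <= X + 1)%N).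
    have {}h3 : (\sum_j l j = l j0 + L')%N by exact: h3.
    have {}h2 : (l j0 <= K')%N by exact: h2.
    by rewrite h1 -/K'; lia.
- rewrite (_ : polyhedron R _ = polyhedron R X1)//; apply: eq_polyhedron => A; rewrite /rook /X1.
  have [hA|hA] := boolP (bounded_by snd l A).
    by rewrite (no_blockers _ hA) andbT.
  rewrite andbF /=; apply/esym/negbTE; apply: contra hA => /andP[_].
  by apply: bounded_byS; exact: finset.subsetUr.
Qed.

End Rook.

(** * From cubes to round spheres *)

Section Spheres.
Variables (R : realType) (n m : nat).
Local Notation V := ('I_n * 'I_m)%type.

Definition coords (M : 'M[R]_(n, m)) (c : V) : R := M c.1 c.2.
Definition of_coords (x : V -> R) : 'M[R]_(n, m) := \matrix_(i, j) x (i, j).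

Lemma of_coordsK x : coords (of_coords x) = x.
Proof. by apply/funext => -[i j]; rewrite /coords mxE. Qed.

Lemma coordsK M : of_coords (coords M) = M.
Proof. by apply/matrixP => i j; rewrite mxE. Qed.

Lemma realizationE (D : {set V} -> bool) M :
  realization R n m D M <-> polyhedron R D (coords M).
Proof.
rewrite /realization /polyhedron /= /coords pair_big /=.
split=> [[M0 [M1 DM]]|[M0 M1 DM]]; first by split.
by split=> // i j; exact: (M0 (i, j)).
Qed.

Definition norm2 t (x : 'rV[R]_t) : R := Num.sqrt (\sum_i x 0 i ^+ 2).

Lemma norm2Z t (a : R) (x : 'rV[R]_t) : norm2 (a *: x) = `|a| * norm2 x.
Proof.
rewrite /norm2 -sqrtr_sqr -sqrtrM ?sqr_ge0// mulr_sumr; congr Num.sqrt.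
by apply: eq_bigr => i _; rewrite mxE exprMn.
Qed.

Lemma norm2_gt0 t (x : 'rV[R]_t) : bdry R t x -> 0 < norm2 x.
Proof.
move=> /bdryP[_ [i xi]]; rewrite sqrtr_gt0 (bigD1 i)//= ltr_wpDr//.
  by apply: sumr_ge0 => j _; exact: sqr_ge0.
by rewrite -real_normK ?num_real// xi expr1n.
Qed.

Lemma within_norm2 t (A : set 'rV[R]_t) : {within A, continuous (@norm2 t)}.
Proof.
apply: (@within_comp _ _ _ _ setT (fun x : 'rV[R]_t => \sum_i x 0 i ^+ 2) Num.sqrt) => //.
  apply: within_sum => i; apply: withinM;
    by apply: continuous_subspaceT; exact: coord_continuous.
by apply: continuous_subspaceT; exact: sqrt_continuous.
Qed.

Lemma sphere_norm2 t (x : 'rV[R]_t.+1) : sphere R t x <-> norm2 x = 1.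
Proof.
rewrite /sphere /norm2 /=; split=> [->|H]; first by rewrite sqrtr1.
have s0 : 0 <= \sum_i x 0 i ^+ 2 by apply: sumr_ge0 => i _; exact: sqr_ge0.
by rewrite -[LHS](sqr_sqrtr s0) H expr1n.
Qed.

Lemma sphere_norm_neq0 t (x : 'rV[R]_t.+1) : sphere R t x -> `|x| != 0.
Proof.
move=> /sphere_norm2 x1; apply/eqP => /normr0_eq0 x0; move: x1.
by rewrite x0 -(scale0r 0) norm2Z normr0 mul0r => /esym/eqP; rewrite oner_eq0.
Qed.

Lemma sph_base_norm2 t : norm2 (sph_base R t) = 1.
Proof.
apply/sphere_norm2; rewrite /sphere /= (bigD1 ord0)//= mxE eqxx expr1n.
by rewrite big1 ?addr0// => i /negbTE i0; rewrite mxE i0 expr0n.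
Qed.

Lemma sph_base_norm t : `|sph_base R t| = 1.
Proof.
apply/bdryP; split; last by exists ord0; rewrite mxE eqxx normr1.
by apply/rV_norm_le => // i; rewrite mxE; case: eqP; rewrite ?normr1 ?normr0.
Qed.

(** Radial projection turns [f] into a map on the boundary of the cube. A filling [F] gives the
    homotopy: each boundary point moves along the segment [w] to the base point, inside the convex
    cube. The base point lies on both the round sphere and the cube boundary, so it stays fixed. *)
Lemma fills_pi_trivial (D : {set V} -> bool) t x0 :
  fills (polyhedron R D) t.+1 -> realization R n m D x0 ->
  pi_trivial R 'M[R]_(n, m) (realization R n m D) x0 t.
Proof.
move=> fD Dx0 f cf fX fb.
pose u (x : 'rV[R]_t.+1) := (norm2 x)^-1 *: x.
have su x : bdry R _ x -> sphere R t (u x).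
  move=> /norm2_gt0 x0'; apply/sphere_norm2; rewrite norm2Z ger0_norm ?invr_ge0 ?ltW//.
  by rewrite mulVf// gt_eqF.
have cu : {within bdry R t.+1, continuous u}.
  apply/within_mx => i j.
  apply: (@within_eq _ _ _ (fun x => (norm2 x)^-1 * x i j)).
    by move=> x _; rewrite mxE.
  apply: withinM; last by apply: continuous_subspaceT; exact: coord_continuous.
  by apply: withinV => [x /norm2_gt0/gt_eqF/negbT//|]; exact: within_norm2.
have [||F [cF DF Ff]] := fD (fun x => coords (f (u x))).
- apply: (@cts_comp _ _ _ _ _ (sphere R t) u (fun y => coords (f y))) => // v.
  by move/within_mx: cf; apply.
- by move=> x /su sx; apply/realizationE; apply: fX; exists (u x).
pose w (q : 'rV[R]_t.+1 * R) : 'rV[R]_t.+1 :=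
  (1 - q.2) *: (`|q.1|^-1 *: q.1) + q.2 *: sph_base R t.
pose K := sphere R t `*` [set` `[(0 : R), 1]].
have bn v : sphere R t v -> bdry R _ (`|v|^-1 *: v).
  move=> /sphere_norm_neq0 v0; rewrite /bdry /= normrZ ger0_norm ?invr_ge0//.
  by rewrite mulVf.
have Fn v : sphere R t v -> F (`|v|^-1 *: v) = coords (f v).
  move=> /[dup] sv /[dup] /sphere_norm_neq0 v0 /bn bv; rewrite Ff// /u norm2Z.
  have /sphere_norm2 -> := sv.
  by rewrite mulr1 ger0_norm ?invr_ge0// invrK scalerA mulfV// scale1r.
have sb : sphere R t (sph_base R t) by apply/sphere_norm2; exact: sph_base_norm2.
have wK q : K q -> cube R _ (w q).
  move=> [s1 /=]; rewrite in_itv /= => /andP[q0 q1].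
  rewrite /cube /= (le_trans (ler_normD _ _))// !normrZ sph_base_norm mulr1.
  rewrite (ger0_norm q0) ger0_norm ?subr_ge0// normfV normr_id mulVf ?sphere_norm_neq0//.
  by rewrite mulr1 subrK.
have cq1 i j : {within K, continuous (fun q : 'rV[R]_t.+1 * R => q.1 i j)}.
  apply: continuous_subspaceT => q.
  apply: (@continuous_comp _ _ _ fst (fun M : 'rV[R]_t.+1 => M i j)).
    exact: cvg_fst.
  exact: coord_continuous.
have cq2 : {within K, continuous (fun q : 'rV[R]_t.+1 * R => q.2)}.
  by apply: continuous_subspaceT => q; exact: cvg_snd.
have cw : {within K, continuous w}.
  apply/within_mx => i j.
  apply: (@within_eq _ _ _ (fun q : 'rV[R]_t.+1 * R => (1 - q.2) * (`|q.1|^-1 * q.1 i j) +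
      q.2 * sph_base R t i j)).
    by move=> q _; rewrite !mxE.
  apply: withinD; last by apply: withinM => //; exact: within_cst.
  apply: withinM; first by apply: withinB => //; exact: within_cst.
  apply: withinM => //; apply: withinV => [q [/sphere_norm_neq0]//|].
  apply: continuous_subspaceT => q.
  apply: (@continuous_comp _ _ _ fst (fun M : 'rV[R]_t.+1 => `|M|)).
    exact: cvg_fst.
  exact: norm_continuous.
have Fb : F (sph_base R t) = coords x0.
  by have := Fn _ sb; rewrite sph_base_norm invr1 scale1r fb.
exists (fun q => of_coords (F (w q))); split.
- apply/within_mx => i j.
  apply: (@within_eq _ _ _ (fun q : 'rV[R]_t.+1 * R => F (w q) (i, j))).
    by move=> q _; rewrite mxE.
  by have := @cts_comp _ _ _ _ _ _ _ F cw wK cF; apply.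
- move=> _ [q Kq <-]; apply/realizationE; rewrite of_coordsK.
  exact/DF/wK.
- move=> v sv; rewrite /w /= subr0 scale1r scale0r addr0 subrr scale0r add0r scale1r.
  by rewrite Fn// Fb !coordsK.
- move=> s _; rewrite /w /= sph_base_norm invr1 scale1r -scalerDl subrK scale1r.
  by rewrite Fb coordsK.
Qed.

End Spheres.

Unset Implicit Arguments.

Theorem theorem6p1 (R : realType) (n m : nat) (k : 'I_n -> nat) (l : 'I_m -> nat) :
  (0 < n)%N -> (0 < m)%N ->
  (\sum_(i < n) k i + n - 1 <= \sum_(j < m) l j)%N ->
  c_connected R ((\sum_(i < n) k i)%N%:Z - 2)
    (realization R n m (rook_face n m k l)).
Proof.
move=> n0 m0 kl.
have ck : conn (polyhedron R (rook_face n m k l)) (\sum_(i < n) k i).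
  rewrite (eq_polyhedron R (rook_faceE k l)); apply: (@rook_conn _ _ _ finset.setT).
    by move=> i; rewrite inE.
  have leq_side a b : (a + n - 1 <= b -> a + n <= b + 1)%N by lia.
  by rewrite cardsT card_ord; exact: leq_side kl.
split=> [K1|t tK x0 Dx0].
  (* Filling in dimension 0 yields a point: the boundary is empty, so any map serves as boundary
     data. *)
  have [|||F [_ DF _]] := ck 0%N _ (fun _ _ => 0).
  - by lia.
  - by move=> v; exact: within_cst.
  - by move=> x /bdryP[_ [[]]].
  exists (of_coords (F 0)); apply/realizationE; rewrite of_coordsK; apply: DF.
  by rewrite /cube /= normr0 ler01.
(* With [K] the total row capacity, [t <= K - 2] gives [t.+1 < K], the range in which [ck]
   applies. *)
apply: fills_pi_trivial => //; apply: ck.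
by lia.
Qed.
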